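(* Let $\Gamma$ be a noncocompact triangle group whose invariant trace field $F_2$ is quadratic over $\mathbb Q$. Then $\mathrm{CR}(\text{cusps of }\Gamma)=\mathrm P^1F_2$.
   Context: For integers (or $\infty$) $2\le l\le m\le n\le\infty$ with $1/l+1/m+1/n<1$, the triangle group $\Delta(l,m,n)<\mathrm{PSL}_2\mathbb R$ is the orientation-preserving index-$2$ subgroup of the group generated by the reflections in the sides of a hyperbolic triangle with angles $\pi/l,\pi/m,\pi/n$ (defined up to conjugation by isometries); it is noncocompact if and only if $n=\infty$. The invariant trace field $F_2$ of a finite-covolume fuchsian group $\Gamma$ is the field generated over $\mathbb Q$ by the traces of the elements of the subgroup $\Gamma^2$ generated by the squares of elements of $\Gamma$. A cusp of $\Gamma$ is a point of $\mathrm P^1\mathbb R$ fixed by a parabolic element of $\Gamma$ (a nonidentity element with trace of absolute value $2$). For $X\subseteq\mathrm P^1\mathbb R$ with at least $3$ elements, $\mathrm{CR}(X)$ is the set of all cross-ratios $(\alpha_1,\alpha_2;\alpha_3,\alpha_4)$ with $\alpha_i\in X$ and $\{\alpha_1,\alpha_2,\alpha_3,\alpha_4\}$ of cardinality at least $3$; one has $\mathrm{CR}(X)\subseteq\mathrm P^1\mathbb R$, and the cross-ratio is in $\{0,1,\infty\}$ if and only if that cardinality is exactly $3$. *)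

(* Defs.v *)
From HB Require Import structures.
From mathcomp Require Import all_boot all_order all_algebra all_field.
From mathcomp Require Import complex.
From mathcomp Require Import all_classical all_reals all_analysis.

Set Implicit Arguments.
Unset Strict Implicit.
Unset Printing Implicit Defensive.

Import Order.TTheory GRing.Theory Num.Theory.

Local Open Scope classical_set_scope.
Local Open Scope ring_scope.

(** * Projective line and cross-ratios *)

(* [Some x] is the affine point x, [None] is the point at infinity. *)
Definition P1 (F : Type) : Type := option F.

(* The point of P^1 F with homogeneous coordinates (x : y) <> (0 : 0). *)
Definition hpoint (F : fieldType) (x y : F) : P1 F :=
  if y == 0 then None else Some (x / y).

Definition mobius (F : fieldType) (g : 'M[F]_2) (p : P1 F) : P1 F :=
  match p with
  | Some z => hpoint (g 0 0 * z + g 0 1) (g 1 0 * z + g 1 1)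
  | None => hpoint (g 0 0) (g 1 0)
  end.

(* Determinant of the standard homogeneous coordinates (x : 1), (1 : 0) of
   two points; it is x - y on affine points. *)
Definition hdet (F : fieldType) (p q : P1 F) : F :=
  match p, q with
  | Some x, Some y => x - y
  | Some _, None => - 1
  | None, Some _ => 1
  | None, None => 0
  end.

(* (p1 - p3)(p2 - p4) / ((p1 - p4)(p2 - p3)); the two homogeneous coordinates
   do not vanish simultaneously as soon as three of the points are distinct. *)
Definition cross_ratio (F : fieldType) (p1 p2 p3 p4 : P1 F) : P1 F :=
  hpoint (hdet p1 p3 * hdet p2 p4) (hdet p1 p4 * hdet p2 p3).

Definition CR (F : fieldType) (X : set (P1 F)) : set (P1 F) :=
  [set c | exists p1 p2 p3 p4 : P1 F,
    [/\ X p1 /\ X p2, X p3 /\ X p4,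
        (3 <= size (undup [:: p1; p2; p3; p4]))%N
      & c = cross_ratio p1 p2 p3 p4]].

(* P^1 K inside P^1 F, for a subset (in practice a subfield) K of F *)
Definition P1_over (F : Type) (K : set F) : set (P1 F) :=
  [set p | if p is Some x then K x else True].

(** * Generated subfields and degrees over Q *)

Definition subfield_gen (F : fieldType) (X : set F) : set F :=
  smallest (fun K : set F => GRing.divring_closed [in K]) X.

Definition rat_degree (F : fieldType) (K : set F) (d : nat) : Prop :=
  exists (L : fieldExtType rat) (f : {rmorphism L -> F}),
    range f = K /\ \dim {: L} = d.

(** * Subgroups of PSL_2(R) and PGL_2(R)

    A subgroup of PGL_2(R) = GL_2(R) / R^* is represented by the matrices of
    determinant 1 or -1 which lie above it, i.e. by a set of matrices which is
    stable under negation; likewise for a subgroup of PSL_2(R) and matrices of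
    determinant 1. *)

(* The subgroup generated by the classes of the matrices in X: adding -1 to the
   generators makes the result stable under negation. For a set of invertible
   matrices, [divr_closed] says that it is a subgroup of GL_2(R). *)
Definition psubgroup_gen (R : realType) (X : set 'M[R]_2) : set 'M[R]_2 :=
  smallest (fun G : set 'M[R]_2 => GRing.divr_closed [in G]) (X `|` [set - 1]).

Definition squares_subgroup (R : realType) (G : set 'M[R]_2) : set 'M[R]_2 :=
  psubgroup_gen [set g * g | g in G].

(* Traces are defined up to sign in PSL_2(R), which does not affect the field
   they generate. *)
Definition invariant_trace_field (R : realType) (G : set 'M[R]_2) : set R :=
  subfield_gen [set \tr g | g in squares_subgroup G].

Definition parabolic (R : realType) (g : 'M[R]_2) : Prop :=
  [/\ g <> 1, g <> - 1 & `|\tr g| = 2].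

Definition cusps (R : realType) (G : set 'M[R]_2) : set (P1 R) :=
  [set p | exists2 g, G g & parabolic g /\ mobius g p = p].

(** * Hyperbolic triangles

    The closed hyperbolic plane is the closed upper half-plane in P^1(C): the
    hyperbolic plane H (Im z > 0) together with the ideal points P^1(R). *)

Definition ideal (R : realType) (p : P1 R[i]) : Prop :=
  if p is Some z then complex.Im z = 0 else True.

Definition in_closed_plane (R : realType) (p : P1 R[i]) : Prop :=
  if p is Some z then 0 <= complex.Im z else True.

(* The orientation-reversing isometries of H are z |-> g (z^* ) with
   \det g = -1, for g unique up to sign. *)
Definition anti_mobius (R : realType) (g : 'M[R]_2) (p : P1 R[i]) : P1 R[i] :=
  mobius (map_mx (real_complex R) g) (omap (@conjc R) p).

(* Reflections are the orientation-reversing involutions. (In PGL_2(R) an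
   involution satisfies g ^+ 2 = 1 or g ^+ 2 = - 1, but the latter is
   impossible if \det g = -1.) *)
Definition reflection (R : realType) (g : 'M[R]_2) : Prop :=
  \det g = - 1 /\ g * g = 1.

(* p lies on the (closure of the) geodesic of fixed points of g; every geodesic
   is the mirror of exactly one reflection. *)
Definition on_mirror (R : realType) (g : 'M[R]_2) (p : P1 R[i]) : Prop :=
  anti_mobius g p = p.

(* The isometry from H to the Poincare disc sending the point v of H to the
   centre, extended to the ideal points: it maps the geodesic rays issued from
   v to radii, and preserves angles. *)
Definition cayley (R : realType) (v : R[i]) (p : P1 R[i]) : R[i] :=
  if p is Some z then (z - v) / (z - conjc v) else 1.

(* The angle at v, in [0, pi], between the geodesic rays from v to p and to q
   (angles at ideal points are 0 by convention). *)
Definition vertex_angle (R : realType) (v p q : P1 R[i]) : R :=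
  match v with
  | Some z =>
      if complex.Im z == 0 then 0 else
      let t := cayley z p / cayley z q in acos (complex.Re (t / `|t|))
  | None => 0
  end.

Definition hyp_triangle (R : realType) (v1 v2 v3 : P1 R[i]) : Prop :=
  [/\ in_closed_plane v1, in_closed_plane v2, in_closed_plane v3
    & ~ exists2 g : 'M[R]_2, reflection g
        & [/\ on_mirror g v1, on_mirror g v2 & on_mirror g v3]].

(** * Triangle groups *)

(* 1 / n, with 1 / oo = 0 *)
Definition recip (R : realType) (n : \bar int) : R :=
  if n is EFin k then k%:~R^-1 else 0.

(* The group generated by the reflections g1, g2, g3 in the sides opposite to
   the vertices v1, v2, v3. *)
Definition is_triangle_group (R : realType) (l m n : \bar int)
    (G : set 'M[R]_2) : Prop :=
  [/\ (2%:E <= l)%E, (l <= m)%E, (m <= n)%E,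
      recip R l + recip R m + recip R n < 1
    & exists (v1 v2 v3 : P1 R[i]) (g1 g2 g3 : 'M[R]_2),
      [/\ hyp_triangle v1 v2 v3,
          [/\ vertex_angle v1 v2 v3 = pi * recip R l,
              vertex_angle v2 v3 v1 = pi * recip R m
            & vertex_angle v3 v1 v2 = pi * recip R n],
          [/\ reflection g1, reflection g2 & reflection g3],
          [/\ on_mirror g1 v2 /\ on_mirror g1 v3,
              on_mirror g2 v3 /\ on_mirror g2 v1
            & on_mirror g3 v1 /\ on_mirror g3 v2]
        & G = [set g | psubgroup_gen [set g1; g2; g3] g /\ \det g = 1]]].

(* Main.v *)
(** Put the cusp at infinity and let a = 2 cos (pi / l), b = 2 cos (pi / m): the
    group is generated by z |-> - z^* + b, z |-> - z^* - a and z |-> 1 / z^*, and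
    K = F_2 contains a^2, b^2 and a b. Group elements have entries in K and in
    the line b K, in a chequerboard pattern, so that the cusps lie in b K and oo.

    Conversely every point w1 / w2 of b K is a cusp. Let ' be the conjugation of
    the quadratic field K, extended to b K by signed square roots a', b' of the
    conjugates of a^2, b^2 with a' b' the conjugate of a b. Going around the
    vertex on the side of w1 / w2 in the triangulation transforms w = (w1, w2),
    w1, w2 > 0, by the inverse of a matrix with nonnegative entries
    sin (j pi / m) / sin (pi / m), the conjugates of which are not larger in
    absolute value. Hence w1 |w2'| + w2 |w1'| does not increase, and it is
    constant during two consecutive steps only if ' fixes a^2, b^2 and a b, which
    would give K = Q. As w1, w2 may be taken integral, this quantity lies in a
    well-ordered set, so the process stops, which it only does at a cusp. *)

Require Import Defs.
From HB Require Import structures.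
From mathcomp Require Import all_boot all_order all_algebra all_field.
From mathcomp Require Import complex.
From mathcomp Require Import all_classical all_reals all_analysis.
From mathcomp Require Import ring lra zify.

Set Implicit Arguments.
Unset Strict Implicit.
Unset Printing Implicit Defensive.

Import Order.TTheory GRing.Theory Num.Theory.

Local Open Scope classical_set_scope.
Local Open Scope ring_scope.

(** * Chebyshev values and the height *)

(** The obstacle is that a single turn around a vertex may keep the height. Equality there informs
    about that vertex only: it gives [|c'| = c], and that c' w1' w2' and c' u1' u2' are at most 0,
    where u is the vector after the turn. The next turn is around the other vertex and starts from
    the same u, so the two sign conditions multiply to a' b' >= 0, hence a' b' = a b. This is why
    heights are compared two turns apart and why signs are recorded with the equality case.

    The conjugates a', b' have to be real. They are, because Chebyshev polynomials have only real
    roots: a negative conjugate of a^2 would give a purely imaginary nonzero root.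

    Since w1 / w2 is in b K, in general w1 and w2 are not both in K. One is taken in the ring O of
    integers of K and the other in a O + b O; a rotation exchanges the roles, and only the squares
    are in K. The square of the height is T + 2 sqrt N, where T and N are the trace and the norm of
    w1^2 w2'^2. Both are natural numbers, so finitely many heights lie below a given bound. *)

Section Chebyshev.
Variable R : realType.
Implicit Types c w u : R.

(* [cheb c n.+1] is the Chebyshev polynomial U_n at [c / 2]. *)
Fixpoint cheb c (n : nat) : R :=
  if n is n1.+1 then
    if n1 is n2.+1 then c * cheb c n1 - cheb c n2 else 1
  else 0.

Lemma chebSS c n : cheb c n.+2 = c * cheb c n.+1 - cheb c n.
Proof. by []. Qed.

(** The matrix with rows (c, -1), (1, 0) has determinant 1, and its power n + 1 has rows
    ([cheb c n.+2], [- cheb c n.+1]), ([cheb c n.+1], [- cheb c n]). *)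
Lemma cheb_det c n : cheb c n.+1 ^+ 2 - cheb c n.+2 * cheb c n = 1.
Proof.
elim: n => [|n IHn]; first by rewrite /=; ring.
rewrite -IHn !chebSS; ring.
Qed.

(** An entry of the product of two powers of the same matrix. *)
Lemma cheb_add c i j :
  cheb c (i + j).+1 = cheb c i.+1 * cheb c j.+1 - cheb c i * cheb c j.
Proof.
elim: j i => [|j IHj] i; first by rewrite addn0 /=; ring.
by rewrite addnS -addSn IHj !chebSS; ring.
Qed.

(** The recursion is symmetric, so the sequence read backwards from its zero at m is a multiple of
    the sequence itself. The factor is a sign, by [cheb_det]. *)
Lemma cheb_subr c m j : (0 < m)%N -> cheb c m = 0 -> (j <= m)%N ->
  cheb c (m - j) = cheb c m.-1 * cheb c j.
Proof.
move=> m0 cm; have [n] := ubnP j; elim: n j => // n IHn [|[|j]] jn jm.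
- by rewrite subn0 cm mulr0.
- by rewrite subn1 mulr1.
have mj2 : (m - j)%N = (m - j.+2).+2 by lia.
have := chebSS c (m - j.+2); rewrite -mj2.
have -> : (m - j.+2).+1 = (m - j.+1)%N by lia.
rewrite (IHn j) ?(IHn j.+1); try lia.
by move=> e; rewrite chebSS; lra.
Qed.

Lemma norm_cheb_subr c m j : (0 < m)%N -> cheb c m = 0 -> (j <= m)%N ->
  `|cheb c (m - j)| = `|cheb c j|.
Proof.
move=> m0 cm jm; rewrite cheb_subr // normrM.
suff -> : `|cheb c m.-1| = 1 by rewrite mul1r.
case: m m0 cm {jm} => [//|[|n]] _ cm; first by move/eqP: cm; rewrite /= oner_eq0.
have := cheb_det c n; rewrite cm mul0r subr0 /= => /eqP.
by rewrite sqrf_eq1 => /orP[]/eqP ->; rewrite ?normrN normr1.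
Qed.

(* A Perron-Frobenius argument: by [cheb_add], the products
   [cheb c i * cheb c j] with [i + j <= m] are sums of values [cheb c k] with
   nonnegative coefficients independent of c, and [cheb c] is positive. *)
Lemma norm_cheb_le c c' m : (1 < m)%N -> cheb c m = 0 -> cheb c' m = 0 ->
  (forall j, (0 < j < m)%N -> 0 < cheb c j) ->
  forall j, (j <= m)%N -> `|cheb c' j| <= cheb c j.
Proof.
move=> m1 cm c'm cpos.
have m0 : (0 < m)%N by lia.
pose F (i : 'I_m) := `|cheb c' i| / cheb c i.
(* The index k maximises the ratio. Index 0 contributes 0 / 0 = 0 and index 1 contributes 1, so the
   maximum r is at least 1 and k is positive. *)
have [k _ kmax] := @arg_maxP _ _ _ (Ordinal m1) xpredT F isT.
set r := F k in kmax.
have r1 : 1 <= r by have := kmax (Ordinal m1) isT; rewrite /F /= normr1 divr1.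
have le_r i : (i <= m)%N -> `|cheb c' i| <= r * cheb c i.
  move=> im; have [->|i0] := eqVneq i 0%N; first by rewrite /= normr0 mulr0.
  have [->|im'] := eqVneq i m; first by rewrite cm c'm normr0 mulr0.
  have im2 : (i < m)%N by lia.
  have ci : 0 < cheb c i by apply: cpos; lia.
  by rewrite -ler_pdivrMr //; exact: (kmax (Ordinal im2)).
have le_rM i j : (i + j <= m)%N ->
    `|cheb c' i| * `|cheb c' j| <= r * (cheb c i * cheb c j).
  elim: i j => [|i IHi] [|j] ij; rewrite ?mulr0 ?mul0r /= ?normr0 ?mul0r ?mulr0 //.
  have -> d : cheb d i.+1 * cheb d j.+1 = cheb d (i + j).+1 + cheb d i * cheb d j.
    by rewrite cheb_add; ring.
  rewrite -normrM.
  have -> d : cheb d i.+1 * cheb d j.+1 = cheb d (i + j).+1 + cheb d i * cheb d j.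
    by rewrite cheb_add; ring.
  rewrite (le_trans (ler_normD _ _)) // mulrDr lerD //.
    by apply: le_r; lia.
  by rewrite normrM; apply: IHi; lia.
have k0 : (0 < k)%N.
  rewrite lt0n; apply/eqP => k0; move: r1; rewrite /r /F k0 /= normr0 mul0r.
  by rewrite ler10.
have km := ltn_ord k.
have sk : 0 < cheb c k by rewrite cpos // k0.
have c'k : `|cheb c' k| = r * cheb c k by rewrite /r /F divfK // gt_eqF.
have norm_c i : (i <= m)%N -> cheb c i = `|cheb c i|.
  move=> im; have [->|i0] := eqVneq i 0%N; first by rewrite /= normr0.
  have [->|im'] := eqVneq i m; first by rewrite cm normr0.
  by rewrite gtr0_norm // cpos //; lia.
move=> j jm.
have : `|cheb c' k| * `|cheb c' j| <= r * (cheb c k * cheb c j).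
  (* If k + j exceeds m, both indices are replaced by their complements in m, whose sum is less than
     m. *)
  have [kj|kj] := leqP (k + j) m; first exact: le_rM.
  have := @le_rM (m - k)%N (m - j)%N.
  rewrite !norm_cheb_subr //; last exact: ltnW.
  rewrite (norm_c (m - k)%N) ?leq_subr // (norm_c (m - j)%N) ?leq_subr //.
  rewrite !norm_cheb_subr //; last exact: ltnW.
  by rewrite -!norm_c //; [apply; lia|exact: ltnW].
(* At k the ratio is exactly r, so r cancels and the bound for j holds with constant 1. *)
rewrite c'k -mulrA ler_pM2l ?(lt_le_trans ltr01) //.
by rewrite ler_pM2l.
Qed.

End Chebyshev.

(** * The height and its change during one turn around a vertex *)

Section Height.
Variable R : realType.
Implicit Types c w u : R.

(** The conjugates are separate arguments: on b K the conjugation depends on chosen square roots, so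
    it is carried along as data. *)
Definition height w1 w1' w2 w2' : R := w1 * `|w2'| + w2 * `|w1'|.

(* With w = T u and |T'| <= T entrywise, write the height of w as a form in u and
   w', and bound |u'| by |T'| |w'| in the height of u. *)
Lemma height_step c c' k w1 w1' w2 w2' :
  let u1 := cheb c k.+1 * w2 - cheb c k * w1 in
  let u2 := cheb c k.+1 * w1 - cheb c k.+2 * w2 in
  let u1' := cheb c' k.+1 * w2' - cheb c' k * w1' in
  let u2' := cheb c' k.+1 * w1' - cheb c' k.+2 * w2' in
  0 <= c -> (forall j, (j <= k.+2)%N -> `|cheb c' j| <= cheb c j) ->
  w1' != 0 -> w2' != 0 -> 0 < u1 -> 0 < u2 ->
  height u1 u1' u2 u2' <= height w1 w1' w2 w2' /\
  (height u1 u1' u2 u2' = height w1 w1' w2 w2' ->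
   [/\ `|c'| = c, c' * (w1' * w2') <= 0 & c' * (u1' * u2') <= 0]).
Proof.
move=> u1 u2 u1' u2' c0 dom w1'0 w2'0 u1_gt0 u2_gt0.
have [d0 d1 d2] : [/\ `|cheb c' k| <= cheb c k, `|cheb c' k.+1| <= cheb c k.+1
   & `|cheb c' k.+2| <= cheb c k.+2] by split; apply: dom; lia.
have det := cheb_det c k; have det' := cheb_det c' k.
have rec := chebSS c k; have rec' := chebSS c' k.
move: @u1 @u2 @u1' @u2' u1_gt0 u2_gt0 d0 d1 d2 det det' rec rec'.
move: (cheb c k) (cheb c k.+1) (cheb c k.+2) => s0 s1 s2.
move: (cheb c' k) (cheb c' k.+1) (cheb c' k.+2) => t0 t1 t2.
move=> u1 u2 u1' u2' u1_gt0 u2_gt0 d0 d1 d2 det det' rec rec'.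
set a1 := `|w1'|; set a2 := `|w2'|.
have a1_gt0 : 0 < a1 by rewrite normr_gt0.
have a2_gt0 : 0 < a2 by rewrite normr_gt0.
(* By [det], the inverse substitution is w1 = s2 u1 + s1 u2, w2 = s1 u1 + s0 u2. *)
have hw : height w1 w1' w2 w2' = u1 * (s2 * a2 + s1 * a1) + u2 * (s1 * a2 + s0 * a1).
  rewrite /height -/a1 -/a2 /u1 /u2.
  transitivity ((s1 ^+ 2 - s2 * s0) * w1 * a2 + (s1 ^+ 2 - s2 * s0) * w2 * a1).
    by rewrite det !mul1r.
  by ring.
have h2 : `|u2'| <= `|t2| * a2 + `|t1| * a1.
  by rewrite /u2' /a1 /a2 -!normrM [leRHS]addrC ler_normB.
have h1 : `|u1'| <= `|t1| * a2 + `|t0| * a1.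
  by rewrite /u1' /a1 /a2 -!normrM ler_normB.
have p2a : `|t2| * a2 <= s2 * a2 by rewrite ler_pM2r.
have p2b : `|t1| * a1 <= s1 * a1 by rewrite ler_pM2r.
have p1a : `|t1| * a2 <= s1 * a2 by rewrite ler_pM2r.
have p1b : `|t0| * a1 <= s0 * a1 by rewrite ler_pM2r.
have g2 : u1 * `|u2'| <= u1 * (s2 * a2 + s1 * a1) by rewrite ler_pM2l //; lra.
have g1 : u2 * `|u1'| <= u2 * (s1 * a2 + s0 * a1) by rewrite ler_pM2l //; lra.
rewrite hw /height; split; first by lra.
(* As u1, u2, a1 and a2 are positive, equal heights turn every estimate used above into an
   equality. *)
move=> eq_h.
have e2 : `|u2'| = s2 * a2 + s1 * a1.
  by apply: (mulfI (lt0r_neq0 u1_gt0)); lra.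
have e1 : `|u1'| = s1 * a2 + s0 * a1.
  by apply: (mulfI (lt0r_neq0 u2_gt0)); lra.
have t2E : `|t2| = s2 by apply: (mulIf (lt0r_neq0 a2_gt0)); lra.
have t1E : `|t1| = s1 by apply: (mulIf (lt0r_neq0 a2_gt0)); lra.
have t0E : `|t0| = s0 by apply: (mulIf (lt0r_neq0 a1_gt0)); lra.
have sq (x : R) : `|x| ^+ 2 = x ^+ 2 by rewrite real_normK // num_real.
have q0 : s0 ^+ 2 = t0 ^+ 2 by rewrite -t0E sq.
have q1 : s1 ^+ 2 = t1 ^+ 2 by rewrite -t1E sq.
have q2 : s2 ^+ 2 = t2 ^+ 2 by rewrite -t2E sq.
have s0_ge0 : 0 <= s0 by rewrite -t0E.
have s1_ge0 : 0 <= s1 by rewrite -t1E.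
have s2_ge0 : 0 <= s2 by rewrite -t2E.
have ctE : c' * t1 = t2 + t0 by rewrite rec' subrK.
have csE : c * s1 = s2 + s0 by rewrite rec subrK.
(* Equal moduli leave open the sign of the cross term in (t2 + t0)^2; the two determinants fix
   it. *)
have tt : t2 * t0 = s2 * s0 by clear -det det' q1; lra.
have ct1 : (c' * t1) ^+ 2 = (c * s1) ^+ 2.
  rewrite ctE csE.
  by rewrite !sqrrD q0 q2 tt.
have s1_neq0 : s1 != 0.
  apply/eqP => s10; have : 0 <= s2 * s0 by apply: mulr_ge0.
  by move: det; rewrite s10; clear; lra.
have cc : c' ^+ 2 = c ^+ 2.
  apply: (@mulIf _ (s1 ^+ 2)); first by rewrite expf_neq0.
  by rewrite {1}q1 -!exprMn.
have a1sq : a1 ^+ 2 = w1' ^+ 2 by exact: sq.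
have a2sq : a2 ^+ 2 = w2' ^+ 2 by exact: sq.
have sqD (x y x' y' : R) : (x * x' + y * y') ^+ 2 =
    x ^+ 2 * x' ^+ 2 + y ^+ 2 * y' ^+ 2 + 2 * (x * y * (x' * y')) by ring.
have aa_ge0 : 0 <= a2 * a1 by rewrite mulr_ge0 // ltW.
(* Equality in the triangle inequality: the cross term of [u2' ^+ 2] is the nonnegative product of
   the moduli. *)
have f2 : t1 * t2 * (w1' * w2') <= 0.
  have : u2' ^+ 2 = (s2 * a2 + s1 * a1) ^+ 2 by rewrite -e2 sq.
  rewrite sqD a1sq a2sq q1 q2 /u2' => e.
  have := mulr_ge0 (mulr_ge0 s2_ge0 s1_ge0) aa_ge0.
  by clear -e; lra.
have f1 : t1 * t0 * (w1' * w2') <= 0.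
  have : u1' ^+ 2 = (s1 * a2 + s0 * a1) ^+ 2 by rewrite -e1 sq.
  rewrite sqD a1sq a2sq q1 q0 /u1' => e.
  have := mulr_ge0 (mulr_ge0 s1_ge0 s0_ge0) aa_ge0.
  by clear -e; lra.
have t1_gt0 : 0 < t1 ^+ 2 by rewrite -q1 exprn_gt0 // lt0r s1_neq0.
have cw : c' * (w1' * w2') <= 0.
  rewrite -(pmulr_rle0 _ t1_gt0).
  have -> : t1 ^+ 2 * (c' * (w1' * w2')) = t1 * (c' * t1) * (w1' * w2') by ring.
  rewrite ctE.
  by clear -f1 f2; lra.
have ss : 0 <= s2 * s0 by apply: mulr_ge0.
split => //.
  have : (c' == c) || (c' == - c) by rewrite -eqf_sqr cc.
  by case/orP => /eqP ->; rewrite ?normrN ger0_norm.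
have m2 : 0 <= c' * t1 * t2.
  rewrite ctE.
  have := sqr_ge0 t2; clear -tt ss; lra.
have m0 : 0 <= c' * t1 * t0.
  rewrite ctE.
  have := sqr_ge0 t0; clear -tt ss; lra.
have -> : c' * (u1' * u2') = (t1 ^+ 2 + t2 * t0) * (c' * (w1' * w2'))
   - (c' * t1 * t2) * w2' ^+ 2 - (c' * t1 * t0) * w1' ^+ 2 by rewrite /u1' /u2'; ring.
have := mulr_ge0 m2 (sqr_ge0 w2'); have := mulr_ge0 m0 (sqr_ge0 w1').
have : (t1 ^+ 2 + t2 * t0) * (c' * (w1' * w2')) <= 0.
  by rewrite pmulr_rle0 // tt ltr_pwDl.
by clear; lra.
Qed.
End Height.

(** * The descent *)

Section Termination.
Variable R : realType.

(** The values of f may be irrational, but each is determined by a pair (T, N), and a bound on f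
    leaves finitely many pairs. The induction is on the number of pairs below the current value. *)
Lemma sqrt_nat_ind (S : Type) (f : S -> R) (P Q : S -> Prop) :
  (forall s, P s -> 0 <= f s /\
     exists T N : nat, f s ^+ 2 = T%:R + 2 * Num.sqrt N%:R) ->
  (forall s, P s -> (forall t, P t -> f t < f s -> Q t) -> Q s) ->
  forall s, P s -> Q s.
Proof.
move=> fP IH s0 Ps0; have [f0 _] := fP _ Ps0.
(* T is at most f^2 and 4 N is at most (T + 2 sqrt N)^2 = f^4, so T and N both stay below this bound
   as long as f does not exceed [f s0]. *)
pose K := Num.bound (f s0 ^+ 2 + f s0 ^+ 4).
have K_gt : f s0 ^+ 2 + f s0 ^+ 4 < K%:R.
  by rewrite archi_boundP // addr_ge0 ?exprn_ge0.
pose mu (x : R) := [set p : 'I_K * 'I_K | p.1%:R + 2 * Num.sqrt p.2%:R < x ^+ 2]%SET.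
suff H n s : P s -> f s <= f s0 -> (#|mu (f s)| < n)%N -> Q s.
  exact: (H _ s0 Ps0 (lexx _) (ltnSn _)).
elim: n s => // n IHn s Ps fs mus; apply: IH => // t Pt ft.
apply: IHn => //; first exact: le_trans (ltW ft) fs.
rewrite -ltnS; apply: leq_trans mus; rewrite ltnS; apply: proper_card.
have [ft0 [T [N eft]]] := fP _ Pt; have [fs0 _] := fP _ Ps.
have lt_sq : f t ^+ 2 < f s ^+ 2 by rewrite ltrXn2r.
have sN : 0 <= Num.sqrt N%:R :> R by rewrite sqrtr_ge0.
have T0 : 0 <= T%:R :> R by rewrite ler0n.
have le0 : f t ^+ 2 <= f s0 ^+ 2.
  by rewrite lerXn2r ?nnegrE // (le_trans (ltW ft)).
have le04 : f t ^+ 4 <= f s0 ^+ 4.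
  by rewrite lerXn2r ?nnegrE // (le_trans (ltW ft)).
have TK : (T < K)%N.
  by rewrite -(ltr_nat R) (le_lt_trans _ K_gt) //; have := exprn_ge0 4 f0; lra.
have NK : (N < K)%N.
  rewrite -(ltr_nat R) (le_lt_trans _ K_gt) //.
  rewrite -[N%:R]sqr_sqrtr //.
  have : f t ^+ 4 = (T%:R + 2 * Num.sqrt N%:R) ^+ 2 by rewrite -eft; ring.
  have := sqr_ge0 (f s0); have := mulr_ge0 T0 sN.
  have := sqr_ge0 (T%:R : R); have := sqr_ge0 (Num.sqrt N%:R : R); lra.
apply/properP; split.
  by apply/fintype.subsetP => p; rewrite !inE => /lt_trans; apply.
(* The pair of t itself is counted for s but not for t. *)
by exists (Ordinal TK, Ordinal NK); rewrite !inE /= -eft ?ltxx.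
Qed.

End Termination.

(** * The descent for abstract cusp and integrality predicates *)

Section Descent.
Variable R : realType.
Implicit Types w u : R.

(* [cheb c] stays positive only at an ideal vertex, where [c = 2]. *)
Definition dominated (c c' : R) :=
  [/\ 0 <= c, (forall j, 0 < cheb c j.+1) -> c = 2
    & forall m, (forall j, (0 < j < m)%N -> 0 < cheb c j) ->
      forall j, (j <= m)%N -> `|cheb c' j| <= cheb c j].

(** The boolean is the side of 0: in the application [c true] is b, [c false] is a, and [C f w1 w2]
    says that w1 / w2, or - w1 / w2 on the side [false], is a cusp. [J] relates an integral vector
    to its conjugate. *)
Variables (c c' : bool -> R) (C : bool -> R -> R -> Prop).
Variable J : R -> R -> R -> R -> Prop.
Hypothesis dom : forall f, dominated (c f) (c' f).
Hypothesis nontrivial : ~ [/\ c' true ^+ 2 = c true ^+ 2,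
  c' false ^+ 2 = c false ^+ 2 & c' true * c' false = c true * c false].
Hypothesis C_rot : forall f w1 w2, C f w2 (c f * w2 - w1) -> C f w1 w2.
Hypothesis C_swap : forall f w1 w2, C f w2 w1 -> C f w1 w2.
Hypothesis C_opp : forall f w1 w2, C (~~ f) w1 (- w2) -> C f w1 w2.
Hypothesis C_infty : forall f w, 0 < w -> C f w 0.
Hypothesis C_diag : forall f w, c f = 2 -> 0 < w -> C f w w.
Hypothesis J_rot : forall f w1 w1' w2 w2', J w1 w1' w2 w2' ->
  J w2 w2' (c f * w2 - w1) (c' f * w2' - w1').
Hypothesis J_swap : forall w1 w1' w2 w2', J w1 w1' w2 w2' -> J w2 w2' w1 w1'.
Hypothesis J_opp : forall w1 w1' w2 w2', J w1 w1' w2 w2' ->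
  J w1 w1' (- w2) (- w2').
Hypothesis J_neq0 : forall w1 w1' w2 w2', J w1 w1' w2 w2' -> w1 != 0 -> w1' != 0.
Hypothesis J_nat : forall w1 w1' w2 w2', J w1 w1' w2 w2' -> exists T N : nat,
  (w1 * w2') ^+ 2 + (w2 * w1') ^+ 2 = T%:R /\ (w1 * w1' * (w2 * w2')) ^+ 2 = N%:R.

(** Rotating around the vertex produces the consecutive pairs of one sequence, starting at w1, w2.
    At its first nonpositive term the point is either infinity or has passed to the other side,
    where [C_opp] takes over. The hypothesis on n ensures that such a term exists. *)
Lemma descent_step_aux f w1 w1' w2 w2' n :
  J w1 w1' w2 w2' -> 0 < w1 -> 0 < w2 ->
  cheb (c f) n.+1 * w2 - cheb (c f) n * w1 <= 0 ->
  C f w1 w2 \/ exists u1 u1' u2 u2',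
    [/\ J u1 u1' u2 u2', 0 < u1 /\ 0 < u2, (C (~~ f) u1 u2 -> C f w1 w2),
     height u1 u1' u2 u2' <= height w1 w1' w2 w2'
   & height u1 u1' u2 u2' = height w1 w1' w2 w2' ->
     [/\ `|c' f| = c f, c' f * (w1' * w2') <= 0 & c' f * (u1' * u2') <= 0]].
Proof.
move=> Jw w1_gt0 w2_gt0 Xn.
have [c_ge0 _ domf] := dom f.
pose X d x1 x2 i := cheb d i.+1 * x2 - cheb d i * x1 : R.
have X0 d x1 x2 : X d x1 x2 0%N = x2 by rewrite /X /=; ring.
have X1 d x1 x2 : X d x1 x2 1%N = d * x2 - x1 by rewrite /X /=; ring.
have XSS d x1 x2 i : X d x1 x2 i.+2 = d * X d x1 x2 i.+1 - X d x1 x2 i.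
  by rewrite /X !chebSS; ring.
have CX i : C f (X (c f) w1 w2 i) (X (c f) w1 w2 i.+1) -> C f w1 w2.
  elim: i => [|i IHi]; first by rewrite X0 X1; exact: C_rot.
  by rewrite XSS => /C_rot; exact: IHi.
have JX i : J (X (c f) w1 w2 i) (X (c' f) w1' w2' i)
              (X (c f) w1 w2 i.+1) (X (c' f) w1' w2' i.+1).
  elim: i => [|i IHi]; first by rewrite !X0 !X1; exact: J_rot.
  by rewrite !XSS; exact: J_rot.
have ex : exists n, X (c f) w1 w2 n <= 0 by exists n.
case: (ex_minnP ex) => -[|k] Xk kmin; first by rewrite X0 leNgt w2_gt0 in Xk.
have Xpos j : (j <= k)%N -> 0 < X (c f) w1 w2 j.
  by move=> jk; rewrite ltNge; apply/negP => /kmin; rewrite leqNgt ltnS jk.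
(* A positive term of the sequence says that [cheb c j.+1 * w2] exceeds [cheb c j * w1], so
   positivity of [cheb] propagates as far as [dominated] needs it. *)
have cpos j : (j <= k)%N -> 0 < cheb (c f) j.+1.
  elim: j => [|j IHj] jk; first exact: ltr01.
  have := Xpos _ jk; rewrite /X subr_gt0 => lt_w.
  rewrite -(pmulr_lgt0 _ w2_gt0); apply: lt_trans lt_w.
  by rewrite mulr_gt0 // IHj // ltnW.
have le_dom j : (j <= k.+2)%N -> `|cheb (c' f) j| <= cheb (c f) j.
  by apply: domf => -[|i] //= ik; apply: cpos.
have [Xk0|Xk0] := eqVneq (X (c f) w1 w2 k.+1) 0.
  by left; apply: (CX k); rewrite Xk0; apply: C_infty; exact: Xpos.
right; exists (X (c f) w1 w2 k), (X (c' f) w1' w2' k).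
exists (- X (c f) w1 w2 k.+1), (- X (c' f) w1' w2' k.+1).
have u2_gt0 : 0 < - X (c f) w1 w2 k.+1 by rewrite oppr_gt0 lt_neqAle Xk0.
have w1'0 : w1' != 0 by apply: (J_neq0 Jw); rewrite gt_eqF.
have w2'0 : w2' != 0 by apply: (J_neq0 (J_swap Jw)); rewrite gt_eqF.
have := @height_step _ (c f) (c' f) k w1 w1' w2 w2' c_ge0 le_dom w1'0 w2'0.
have E d x1 x2 : cheb d k.+1 * x1 - cheb d k.+2 * x2 = - X d x1 x2 k.+1.
  by rewrite /X; ring.
rewrite !E => /(_ (Xpos k (leqnn k)) u2_gt0)[H1 H2]; split=> //.
- exact/J_opp/JX.
- by rewrite Xpos.
- by move=> /C_opp; exact: CX.
Qed.

Lemma cheb2 n : cheb (2 : R) n = n%:R.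
Proof.
have [m] := ubnP n; elim: m n => // m IHm [|[|n]] nm //.
rewrite chebSS !IHm; try lia.
by rewrite !mulrSr; ring.
Qed.

Lemma heightC w1 w1' w2 w2' : height w1 w1' w2 w2' = height w2 w2' w1 w1'.
Proof. by rewrite /height addrC. Qed.

Lemma descent_step f w1 w1' w2 w2' :
  J w1 w1' w2 w2' -> 0 < w1 -> 0 < w2 ->
  C f w1 w2 \/ exists u1 u1' u2 u2',
    [/\ J u1 u1' u2 u2', 0 < u1 /\ 0 < u2, (C (~~ f) u1 u2 -> C f w1 w2),
     height u1 u1' u2 u2' <= height w1 w1' w2 w2'
   & height u1 u1' u2 u2' = height w1 w1' w2 w2' ->
     [/\ `|c' f| = c f, c' f * (w1' * w2') <= 0 & c' f * (u1' * u2') <= 0]].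
Proof.
move=> Jw w1_gt0 w2_gt0; have [_ c2 _] := dom f.
have [cpos|] := pselect (forall j, 0 < cheb (c f) j.+1); last first.
  move=> /existsNP[n /negP]; rewrite -leNgt => cn.
  have ex : exists n, cheb (c f) n.+1 <= 0 by exists n.
  case: (ex_minnP ex) => -[|k] ck kmin; first by rewrite /= ler10 in ck.
  have cpos : 0 < cheb (c f) k.+1.
    by rewrite ltNge; apply/negP => /kmin; rewrite ltnn.
  apply: (@descent_step_aux f _ _ _ _ k.+1) => //.
  have := mulr_gt0 cpos w1_gt0; have : cheb (c f) k.+2 * w2 <= 0.
    by rewrite pmulr_lle0.
  by lra.
have {}c2 := c2 cpos.
(* At an ideal vertex the sequence is x2 - n (x1 - x2), which decreases only if x2 < x1. The
   opposite case is reduced to this one by the reflection [C_swap], and equality is the ideal vertex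
   itself. *)
have X x1 x2 : x2 < x1 -> exists n, cheb (c f) n.+1 * x2 - cheb (c f) n * x1 <= 0.
  move=> x12; pose n := Num.bound (`|x2| / (x1 - x2)).
  have d0 : 0 < x1 - x2 by rewrite subr_gt0.
  have : `|x2| / (x1 - x2) < n%:R.
    by rewrite archi_boundP // divr_ge0 // ltW.
  rewrite ltr_pdivrMr // => lt_n; exists n.
  rewrite c2 !cheb2 mulrSr; have := ler_norm x2; lra.
have [w12|w21|w12] := ltgtP w1 w2; last by left; rewrite -w12; exact: C_diag.
  have [n Xn] := X _ _ w12.
  have := @descent_step_aux f _ _ _ _ n (J_swap Jw) w2_gt0 w1_gt0 Xn.
  move=> [/C_swap|[u1 [u1' [u2 [u2' [Ju u0 Cu le_u eq_u]]]]]]; first by left.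
  right; exists u1, u1', u2, u2'; split=> //.
  - by move=> /Cu/C_swap.
  - by rewrite (heightC w1).
  - by rewrite (heightC w1) (mulrC w1').
have [n Xn] := X _ _ w21.
exact: (@descent_step_aux f _ _ _ _ n).
Qed.

Lemma descent f w1 w1' w2 w2' :
  J w1 w1' w2 w2' -> 0 < w1 -> 0 < w2 -> C f w1 w2.
Proof.
pose P (s : bool * (R * R * (R * R))) := let: (_, (x1, x1', (x2, x2'))) := s in
  [/\ J x1 x1' x2 x2', 0 < x1 & 0 < x2].
pose Q (s : bool * (R * R * (R * R))) := let: (f, (x1, _, (x2, _))) := s in
  C f x1 x2.
pose F (s : bool * (R * R * (R * R))) := let: (_, (x1, x1', (x2, x2'))) := s in
  height x1 x1' x2 x2'.
move=> Jw w1_gt0 w2_gt0.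
suff : Q (f, (w1, w1', (w2, w2'))) by [].
apply: (@sqrt_nat_ind _ _ F P Q) => // {f w1 w1' w2 w2' Jw w1_gt0 w2_gt0}.
  move=> [f [[w1 w1'] [w2 w2']]] [Jw w1_gt0 w2_gt0] /=; split.
    by rewrite addr_ge0 // mulr_ge0 // ltW.
  have [T [N [eT eN]]] := J_nat Jw; exists T, N.
  rewrite -eT -eN sqrtr_sqr /height !normrM sqrrD !exprMn !real_normK ?num_real //.
  by rewrite (gtr0_norm w1_gt0) (gtr0_norm w2_gt0); ring.
move=> [f [[w1 w1'] [w2 w2']]] [Jw w1_gt0 w2_gt0] IH /=.
have := @descent_step f _ _ _ _ Jw w1_gt0 w2_gt0.
move=> [//|[u1 [u1' [u2 [u2' [Ju [u1_gt0 u2_gt0] Cu le_u eq_u]]]]]].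
have := @descent_step (~~ f) _ _ _ _ Ju u1_gt0 u2_gt0.
move=> [/Cu//|[t1 [t1' [t2 [t2' [Jt [t1_gt0 t2_gt0] Ct le_t eq_t]]]]]].
apply/Cu/Ct; apply: (IH (_, (t1, t1', (t2, t2')))) => //=.
rewrite lt_neqAle (le_trans le_t le_u) andbT; apply/eqP => tw.
have tu : height t1 t1' t2 t2' = height u1 u1' u2 u2'.
  by apply/eqP; rewrite eq_le le_t tw le_u.
have [cf _ cfu] := eq_u (etrans (esym tu) tw).
have [cnf cnfu _] := eq_t tu.
apply: nontrivial.
have c0 g : 0 <= c g by case: (dom g).
have u1'0 : u1' != 0 by apply: (J_neq0 Ju); rewrite gt_eqF.
have u2'0 : u2' != 0 by apply: (J_neq0 (J_swap Ju)); rewrite gt_eqF.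
have sq g : `|c' g| = c g -> c' g ^+ 2 = c g ^+ 2.
  by move=> <-; rewrite real_normK ?num_real.
(* The moduli give this up to sign. The sign comes from the two conditions on the shared product u1'
   u2'. *)
have cc : c' f * c' (~~ f) = c f * c (~~ f).
  rewrite -cf -cnf -normrM ger0_norm //.
  have uu_gt0 : 0 < (u1' * u2') ^+ 2.
    by rewrite exprn_even_gt0 //= mulf_neq0.
  rewrite -(pmulr_lge0 _ uu_gt0).
  have -> : c' f * c' (~~ f) * (u1' * u2') ^+ 2 =
    (c' f * (u1' * u2')) * (c' (~~ f) * (u1' * u2')) by ring.
  exact: mulr_le0.
by case: f cf cnf cc {IH Cu eq_u eq_t cfu cnfu Ct} => /= h1 h2 h3;
  split; try exact: sq; rewrite // mulrC h3 mulrC.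
Qed.

End Descent.

(** * Integers of a real quadratic field *)

Section Integrality.
Variable R : realType.
Implicit Types c x : R.

Definition zintegral x := integralOver (intr : int -> R) x.

Fixpoint chebP (n : nat) : {poly int} :=
  if n is n1.+1 then
    if n1 is n2.+1 then 'X * chebP n1 - chebP n2 else 1
  else 0.

#[local] Arguments chebP : simpl nomatch.
#[local] Arguments cheb {R} c n : simpl nomatch.

Lemma chebPSS n : chebP n.+2 = 'X * chebP n.+1 - chebP n.
Proof. by []. Qed.

Lemma horner_chebP c n : (map_poly intr (chebP n)).[c] = cheb c n.
Proof.
have [m] := ubnP n; elim: m n => // m IHm [|[|n]] nm.
- by rewrite /= rmorph0 horner0.
- by rewrite /= rmorph1 hornerC.
rewrite chebSS chebPSS rmorphB rmorphM /= map_polyX.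
rewrite hornerD hornerN hornerM hornerX IHm ?(IHm n) //; lia.
Qed.

Lemma chebP_monic n : size (chebP n.+1) = n.+1 /\ chebP n.+1 \is monic.
Proof.
suff [] : (size (chebP n.+1) = n.+1 /\ chebP n.+1 \is monic) /\
          (size (chebP n.+2) = n.+2 /\ chebP n.+2 \is monic) by [].
elim: n => [|n [IH1 [sz mon]]]; split=> //.
- by rewrite size_poly1 monic1.
- by rewrite /= mulr1 subr0 size_polyX monicX.
rewrite chebPSS.
have szX : size ('X * chebP n.+2) = n.+3.
  by rewrite mulrC size_mulX ?sz // -size_poly_eq0 sz.
have lt_sz : (size (- chebP n.+1)%R < size ('X * chebP n.+2)%R)%N.
  by rewrite szX size_polyN IH1.1; lia.
rewrite size_polyDl // szX; split=> //.
by rewrite monicE lead_coefDl // -monicE monicMl // monicX.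
Qed.

Lemma zintegral_cheb c n : cheb c n.+1 = 0 -> zintegral c.
Proof.
move=> cn; exists (chebP n.+1); first by case: (chebP_monic n).
by apply/rootP; rewrite horner_chebP.
Qed.

Lemma zintegral_nat n : zintegral n%:R.
Proof. exact: integral_nat. Qed.

Lemma zintegral_rat (p : rat) : zintegral (ratr p) -> exists z : int, p = z%:~R.
Proof.
move=> [P Pmon /rootP Pp].
have e : map_poly (ratr : rat -> R) (map_poly intr P) = map_poly intr P.
  by rewrite -map_poly_comp; apply: eq_map_poly => z /=; rewrite ratr_int.
have {Pp} rootp : root (map_poly intr P) p.
  by rewrite -(fmorph_root (ratr : rat -> R)) e; apply/rootP.
have e' : map_poly (ratr : rat -> algC) (map_poly intr P) = map_poly intr P.
  by rewrite -map_poly_comp; apply: eq_map_poly => z /=; rewrite ratr_int.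
(* The polynomial has integer coefficients, so its rational root can be viewed in [algC], where a
   rational algebraic integer is an integer. *)
have : (ratr p : algC) \in Num.int.
  apply: Cint_rat_Aint; first exact: Crat_rat.
  apply: (@root_monic_Aint (map_poly intr P)).
  - by rewrite -e' fmorph_root.
  - exact: monic_map.
  - by apply/polyOverP => i; rewrite coef_map /= intr_int.
move=> /intrP[z pz]; exists z; apply: (@fmorph_inj _ _ (ratr : rat -> algC)).
by rewrite /= pz ratr_int.
Qed.

End Integrality.

(** * Conjugation and integers in Q(s) *)

Section QuadraticField.
Variables (R : realType) (s : R) (d : rat).
Hypothesis s_sqr : s ^+ 2 = ratr d.
Hypothesis s_irr : forall q : rat, s <> ratr q.
Implicit Types x y : R.

(** The graph of the conjugation, as a relation on R: no coordinates have to be chosen for elements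
    of Q(s), and irrationality of s makes it single-valued. *)
Definition quad_conj x x' := exists p q : rat,
  x = ratr p + ratr q * s /\ x' = ratr p - ratr q * s.

Lemma quad_conj_sym x x' : quad_conj x x' -> quad_conj x' x.
Proof.
by move=> [p [q [-> ->]]]; exists p, (- q); rewrite rmorphN mulNr opprK.
Qed.

Lemma quad_conj_rat p : quad_conj (ratr p) (ratr p).
Proof. by exists p, 0; rewrite rmorph0 mul0r subr0 addr0. Qed.

Lemma quad_conjD x x' y y' :
  quad_conj x x' -> quad_conj y y' -> quad_conj (x + y) (x' + y').
Proof.
move=> [p [q [-> ->]]] [u [v [-> ->]]]; exists (p + u), (q + v).
by rewrite !rmorphD /=; split; ring.
Qed.

Lemma quad_conjN x x' : quad_conj x x' -> quad_conj (- x) (- x').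
Proof.
move=> [p [q [-> ->]]]; exists (- p), (- q).
by rewrite !rmorphN /=; split; ring.
Qed.

Lemma quad_conjB x x' y y' :
  quad_conj x x' -> quad_conj y y' -> quad_conj (x - y) (x' - y').
Proof. by move=> xx' /quad_conjN; exact: quad_conjD. Qed.

Lemma quad_conjM x x' y y' :
  quad_conj x x' -> quad_conj y y' -> quad_conj (x * y) (x' * y').
Proof.
move=> [p [q [-> ->]]] [u [v [-> ->]]].
exists (p * u + q * v * d), (p * v + q * u).
by rewrite !rmorphD !rmorphM /= -s_sqr; split; ring.
Qed.

Lemma quad_conj_neq0 x x' : quad_conj x x' -> x != 0 -> x' != 0.
Proof.
move=> [p [q [-> ->]]]; apply: contraNN; rewrite subr_eq0 => /eqP pq.
have [q0|q0] := eqVneq q 0; first by rewrite pq q0 rmorph0 !mul0r addr0.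
case: (@s_irr (p / q)); rewrite fmorph_div /= pq (mulrC _ s) mulfK //.
by rewrite fmorph_eq0.
Qed.

Lemma quad_conjV x x' : quad_conj x x' -> x != 0 -> quad_conj x^-1 x'^-1.
Proof.
move=> xx' x0; have x'0 := quad_conj_neq0 xx' x0.
case: xx' x0 x'0 => [p [q [-> ->]]] x0 x'0.
pose N := p ^+ 2 - q ^+ 2 * d.
have NE : ratr N = (ratr p + ratr q * s) * (ratr p - ratr q * s).
  by rewrite /N !expr2 rmorphB !rmorphM /= -s_sqr; ring.
exists (p / N), (- q / N); rewrite !fmorph_div rmorphN /= NE.
by split; field; rewrite x0 x'0.
Qed.

Lemma quad_conj_uniq x x' x'' : quad_conj x x' -> quad_conj x x'' -> x' = x''.
Proof.
move=> h1 h2; have h := quad_conjB h1 h2; apply/eqP; rewrite -subr_eq0.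
apply: contraT => /(quad_conj_neq0 (quad_conj_sym h)).
by rewrite subrr eqxx.
Qed.

Lemma quad_conj_id x : quad_conj x x -> exists p : rat, x = ratr p.
Proof.
move=> [p [q [-> e]]]; exists p.
have -> : ratr q * s = 0 :> R by lra.
by rewrite addr0.
Qed.

(** Integrality of both conjugates is part of the definition, so that trace and norm are integral
    without moving polynomials through the conjugation. *)
Definition quad_int x x' := [/\ quad_conj x x', zintegral x & zintegral x'].

Lemma quad_int_sym x x' : quad_int x x' -> quad_int x' x.
Proof. by move=> [/quad_conj_sym ? ? ?]. Qed.

Lemma quad_intD x x' y y' :
  quad_int x x' -> quad_int y y' -> quad_int (x + y) (x' + y').
Proof.
move=> [? ? ?] [? ? ?].
by split; [exact: quad_conjD|exact: integral_add|exact: integral_add].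
Qed.

Lemma quad_intN x x' : quad_int x x' -> quad_int (- x) (- x').
Proof.
move=> [? ? ?].
by split; [exact: quad_conjN|exact: integral_opp|exact: integral_opp].
Qed.

Lemma quad_intM x x' y y' :
  quad_int x x' -> quad_int y y' -> quad_int (x * y) (x' * y').
Proof.
move=> [? ? ?] [? ? ?].
by split; [exact: quad_conjM|exact: integral_mul|exact: integral_mul].
Qed.

Lemma quad_int_nat n : quad_int n%:R n%:R.
Proof.
by split; [rewrite -(ratr_nat R); exact: quad_conj_rat| |]; exact: zintegral_nat.
Qed.

Lemma quad_int_rat x x' (p : rat) : quad_int x x' -> x = ratr p -> 0 <= x ->
  exists n : nat, x = n%:R.
Proof.
move=> [_ + _] xp; rewrite xp => /zintegral_rat[z ->].
by rewrite ratr_int ler0z; case: z => // n _; exists n.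
Qed.

Lemma quad_int_trace x x' : quad_int x x' -> 0 <= x + x' ->
  exists n : nat, x + x' = n%:R.
Proof.
move=> xx'; have [[p [q [ex ex']]] _ _] := xx'.
apply: (quad_int_rat (p := 2 * p)).
  exact: (quad_intD xx' (quad_int_sym xx')).
by rewrite ex ex' rmorphM /= ratr_nat; ring.
Qed.

Lemma quad_int_norm x x' : quad_int x x' -> 0 <= x * x' ->
  exists n : nat, x * x' = n%:R.
Proof.
move=> xx'; have [[p [q [ex ex']]] _ _] := xx'.
apply: (quad_int_rat (p := p ^+ 2 - q ^+ 2 * d)).
  exact: (quad_intM xx' (quad_int_sym xx')).
by rewrite ex ex' !expr2 rmorphB !rmorphM /= -s_sqr; ring.
Qed.

Lemma quad_int_clear p q : exists2 k : nat, (0 < k)%N &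
  quad_int (k%:R * (ratr p + ratr q * s)) (k%:R * (ratr p - ratr q * s)).
Proof.
pose k := absz (denq p * denq q * denq d).
have kE : k%:R = ratr (denq p * denq q * denq d)%:~R :> R.
  rewrite ratr_int /k -[LHS]/((Posz (absz _))%:~R) gez0_abs //.
  by rewrite !mulr_ge0 // ltW.
exists k; first by rewrite /k absz_gt0 !mulf_neq0.
have kp : k%:R * ratr p = ratr (numq p * denq q * denq d)%:~R :> R.
  rewrite kE -rmorphM /= -[X in ratr (_ * X)]divq_num_den !rmorphM /=.
  by field; rewrite ?ratr_int ?fmorph_eq0 ?intr_eq0 denq_neq0.
(* Since d is only rational, s need not be integral, but (denq d s)^2 = numq d denq d is an integer.
   Hence the factor [denq d] in k. *)
have zd : zintegral (ratr (denq d)%:~R * s : R).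
  exists ('X^2 - (numq d * denq d)%:P).
    by rewrite monicE lead_coefDl ?lead_coefXn // size_polyXn size_polyN size_polyC; case: eqP.
  apply/rootP; rewrite rmorphB /= map_polyXn map_polyC /= hornerD hornerN hornerC hornerXn.
  rewrite exprMn s_sqr -(ratr_int R) -[X in _ * ratr X]divq_num_den !rmorphM /=.
  by field; rewrite ?ratr_int ?fmorph_eq0 ?intr_eq0 denq_neq0.
have zZ (z : int) : zintegral (ratr z%:~R : R).
  by rewrite ratr_int; exact: (integral_id (intr : int -> R)).
have kq : k%:R * ratr q = ratr (denq p * numq q)%:~R * ratr (denq d)%:~R :> R.
  rewrite kE -rmorphM /= -[X in ratr (_ * X)]divq_num_den !rmorphM /=.
  by field; rewrite ?ratr_int ?fmorph_eq0 ?intr_eq0 denq_neq0.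
have zq : zintegral (k%:R * ratr q * s : R).
  by rewrite kq -mulrA; apply: integral_mul; [exact: zZ|exact: zd].
have zp : zintegral (k%:R * ratr p : R) by rewrite kp; exact: zZ.
rewrite mulrDr mulrBr (mulrA _ (ratr q)); split; [|exact: (integral_add zp zq)|exact: (integral_sub zp zq)].
by exists (k%:R * p), (k%:R * q); rewrite !rmorphM /= ratr_nat.
Qed.

End QuadraticField.

(** * Conjugates of the numbers 2 cos (pi / m) *)

Section TriangleParameters.
Variable R : realType.
Implicit Types c x : R.

(* c = 2 cos (pi / m), including m = oo *)
Definition tri_param c := 0 <= c /\
  ((exists m, [/\ (1 < m)%N, cheb c m = 0 &
      forall j, (0 < j < m)%N -> 0 < cheb c j]) \/ c = 2).

(* [cheb c n] is [cheb_half (c ^+ 2) n] for n odd, and [c] times it for n even. *)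
Fixpoint cheb_half (x : R) (n : nat) : R :=
  if n is n1.+1 then
    if n1 is n2.+1 then
      (if odd n2 then x else 1) * cheb_half x n1 - cheb_half x n2
    else 1
  else 0.

Lemma cheb_halfSS x n : cheb_half x n.+2 =
  (if odd n then x else 1) * cheb_half x n.+1 - cheb_half x n.
Proof. by []. Qed.

#[local] Arguments cheb_half : simpl never.
#[local] Arguments cheb {R} c n : simpl never.

Lemma cheb_halfE c n :
  cheb c n = (if odd n then 1 else c) * cheb_half (c ^+ 2) n.
Proof.
have [m] := ubnP n; elim: m n => // m IHm [|[|n]] nm; rewrite ?mulr0 ?mulr1 //.
rewrite chebSS cheb_halfSS IHm ?(IHm n); try lia.
by rewrite /= negbK; case: (odd n) => /=; ring.
Qed.

(** A negative x is the square of an imaginary number, where Chebyshev polynomials alternate: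
    indices 2k + 1 and 2k + 2 have the sign of (-1)^k. This is what makes the conjugate of [c ^+ 2]
    nonnegative. *)
Lemma cheb_half_neq0 x n : x < 0 -> cheb_half x n.+1 != 0.
Proof.
move=> x_lt0.
have H k : 0 < (-1) ^+ k * cheb_half x k.*2.+1 /\
           0 < (-1) ^+ k * cheb_half x k.*2.+2.
  elim: k => [|k [IH1 IH2]]; first by rewrite !mul1r cheb_halfSS /= mulr1 subr0 ltr01.
  have e1 : cheb_half x k.*2.+3 = x * cheb_half x k.*2.+2 - cheb_half x k.*2.+1.
    by rewrite cheb_halfSS /= odd_double.
  have e2 : cheb_half x k.*2.+4 = cheb_half x k.*2.+3 - cheb_half x k.*2.+2.
    by rewrite cheb_halfSS /= odd_double mul1r.
  have h1 : 0 < (-1) ^+ k.+1 * cheb_half x k.*2.+3.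
    rewrite e1 exprS.
    have : 0 < - x * ((-1) ^+ k * cheb_half x k.*2.+2) by rewrite mulr_gt0 ?oppr_gt0.
    by lra.
  split=> //; rewrite doubleS e2; move: h1; rewrite exprS; lra.
have := odd_double_half n; case: (odd n) => /= <-; have [h1 h2] := H n./2.
  by apply: contraL h2 => /eqP ->; rewrite mulr0 ltxx.
by apply: contraL h1 => /eqP; rewrite add0n => ->; rewrite mulr0 ltxx.
Qed.

End TriangleParameters.

Section QuadraticDescent.
Variables (R : realType) (s : R) (d : rat).
Hypothesis s_sqr : s ^+ 2 = ratr d.
Hypothesis s_irr : forall q : rat, s <> ratr q.
Implicit Types x y : R.

Local Notation qconj := (quad_conj s).
Local Notation qint := (quad_int s).

Lemma quad_conj_nat n : qconj n%:R n%:R.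
Proof. by rewrite -(ratr_nat R); exact: quad_conj_rat. Qed.

Lemma quad_conj_cheb_half x x' n :
  qconj x x' -> qconj (cheb_half x n) (cheb_half x' n).
Proof.
move=> xx'; have [m] := ubnP n; elim: m n => // m IHm [|[|n]] nm.
- exact: (quad_conj_nat 0).
- exact: (quad_conj_nat 1).
rewrite !cheb_halfSS; apply: quad_conjB; last by apply: IHm; lia.
apply: (quad_conjM s_sqr); last by apply: IHm; lia.
by case: odd => //; exact: (quad_conj_nat 1).
Qed.

(** Only [c ^+ 2] is assumed to be in the quadratic field. The vanishing of [cheb c m] is expressed
    through [cheb_half], a polynomial in [c ^+ 2], and so passes to either square root of the
    conjugate y. *)
Lemma tri_param_conj (c y : R) : tri_param c -> qconj (c ^+ 2) y ->
  [/\ 0 <= y, zintegral c & forall c' : R, c' ^+ 2 = y ->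
    dominated c c' /\ zintegral c'].
Proof.
move=> [c_ge0 [[m [m1 cm cpos]]|c2]] cy; last first.
  have {cy} y4 : y = 4.
    apply: (quad_conj_uniq s_irr cy).
    have -> : c ^+ 2 = 4%:R by rewrite c2; ring.
    exact: quad_conj_nat.
  split; first by rewrite y4.
    by rewrite c2; exact: (zintegral_nat _ 2).
  move=> c' /eqP; rewrite y4 (_ : 4 = 2 ^+ 2); last by ring.
  rewrite eqf_sqr => c'2.
  have abs_le j : `|cheb c' j| <= cheb c j.
    have -> : `|cheb c' j| = `|cheb c j|.
      rewrite !cheb_halfE c2.
      by case/orP: c'2 => /eqP ->; rewrite ?sqrrN !normrM //; case: odd; rewrite ?normrN.
    by rewrite c2 cheb2 ger0_norm.
  split; first by split.
  case/orP: c'2 => /eqP ->; first exact: (zintegral_nat _ 2).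
  exact/integral_opp/(zintegral_nat _ 2).
have c'm c' : c' ^+ 2 = y -> cheb c' m = 0.
  (* For even m the value [cheb c m] has a factor c, so c = 0 is treated apart; then c' = 0 as
     well. *)
  move=> c'y; have [c0|c0] := eqVneq c 0.
    suff -> : c' = c by [].
    apply/eqP; rewrite c0 -sqrf_eq0 c'y; apply/eqP.
    apply: (quad_conj_uniq s_irr cy).
    rewrite c0 expr0n; exact: (quad_conj_nat 0).
  have h0 : cheb_half (c ^+ 2) m = 0.
    move: cm; rewrite cheb_halfE => /eqP; rewrite mulf_eq0 => /orP[|/eqP//].
    by case: odd; rewrite ?oner_eq0 // (negPf c0).
  rewrite cheb_halfE c'y (_ : cheb_half y m = 0) ?mulr0 //.
  apply: (quad_conj_uniq s_irr (quad_conj_cheb_half m cy)).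
  rewrite h0; exact: (quad_conj_nat 0).
have m_prec : m = m.-2.+2 by lia.
split.
- have [c0|c0] := eqVneq c 0.
    suff -> : y = 0 by [].
    apply: (quad_conj_uniq s_irr cy).
    rewrite c0 expr0n; exact: (quad_conj_nat 0).
  rewrite leNgt; apply/negP => y_lt0.
  have h0 : cheb_half (c ^+ 2) m = 0.
    move: cm; rewrite cheb_halfE => /eqP; rewrite mulf_eq0 => /orP[|/eqP//].
    by case: odd; rewrite ?oner_eq0 // (negPf c0).
  have := quad_conj_cheb_half m cy; rewrite h0 => /(quad_conj_uniq s_irr).
  move=> /(_ _ (quad_conj_nat 0))/eqP; apply/negP.
  by rewrite m_prec cheb_half_neq0.
- by apply: (@zintegral_cheb _ _ m.-1); rewrite prednK //; lia.
move=> c' c'y; split; last first.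
  by apply: (@zintegral_cheb _ _ m.-1); rewrite prednK ?c'm //; lia.
split=> //.
  by move=> /(_ m.-1); rewrite prednK ?cm ?ltxx //; lia.
(* A range on which [cheb c] is positive cannot pass its zero m, so j is at most m. *)
move=> n npos j jn; apply: (@norm_cheb_le _ c c' m) => //; first exact: c'm.
rewrite leqNgt; apply/negP => mj.
by have := npos m; rewrite cm ltxx => /(_ _)/negP; apply=> //; lia.
Qed.

Variable c : bool -> R.
Hypothesis c_param : forall f, tri_param (c f).
Hypothesis c_gt0 : 0 < c true.
Hypothesis c_sqr : forall f, exists y, qconj (c f ^+ 2) y.
Hypothesis c_mul : exists y, qconj (c true * c false) y.
Hypothesis c_irr : ~ exists p q r : rat,
  [/\ c true ^+ 2 = ratr p, c false ^+ 2 = ratr q & c true * c false = ratr r].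

Lemma tri_param_conjs : exists c' : bool -> R,
  [/\ forall f, dominated (c f) (c' f), forall f, qint (c f ^+ 2) (c' f ^+ 2)
    & qint (c true * c false) (c' true * c' false)].
Proof.
have [y1 cy1] := c_sqr true; have [y0 cy0] := c_sqr false.
have [y cy] := c_mul.
have [y1_ge0 z1 dom1] := tri_param_conj (c_param true) cy1.
have [y0_ge0 z0 dom0] := tri_param_conj (c_param false) cy0.
have yE : y ^+ 2 = y1 * y0.
  apply: (quad_conj_uniq s_irr (quad_conjM s_sqr cy cy)).
  rewrite mulrACA -!expr2; exact: (quad_conjM s_sqr).
(* The root b' is positive and a' takes the sign of the conjugate y of a b, so that a' b' = y. *)
pose b' := Num.sqrt y1; pose a' := Num.sg y * Num.sqrt y0.
have b'E : b' ^+ 2 = y1 by rewrite sqr_sqrtr.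
have ab : b' * a' = y.
  by rewrite mulrCA -sqrtrM // -yE sqrtr_sqr -numEsg.
(* If y = 0, the sign is 0 and a' is 0; this is still a root of y0, since y1 y0 = 0 and b > 0 gives
   y1 != 0. *)
have [a0|a'E] : a' ^+ 2 = 0 /\ y = 0 /\ y0 != 0 \/ a' ^+ 2 = y0.
  rewrite exprMn sqr_sg sqr_sqrtr //.
  have [->|] := eqVneq y 0 => /=; last by right; rewrite mul1r.
  by rewrite mul0r; have [->|] := eqVneq y0 0; [right|left].
have := yE; case: a0 => [_ [-> y00]] /eqP; rewrite expr0n /= eq_sym mulf_eq0 (negPf y00) orbF => /eqP y10.
  move: (quad_conj_neq0 s_irr cy1); rewrite y10 eqxx expf_neq0 ?gt_eqF //.
  by move=> /(_ isT).
have [db zb] := dom1 _ b'E; have [da za] := dom0 _ a'E.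
exists (fun f => if f then b' else a'); split.
- by case.
- case; [rewrite b'E|rewrite a'E]; split=> //; rewrite -?b'E -?a'E expr2; exact: integral_mul.
- split; first by rewrite ab.
    exact: integral_mul z1 z0.
  exact: integral_mul zb za.
Qed.

Lemma quadratic_descent (C : bool -> R -> R -> Prop) :
  (forall f w1 w2, C f w2 (c f * w2 - w1) -> C f w1 w2) ->
  (forall f w1 w2, C f w2 w1 -> C f w1 w2) ->
  (forall f w1 w2, C (~~ f) w1 (- w2) -> C f w1 w2) ->
  (forall f w, 0 < w -> C f w 0) ->
  (forall f w, c f = 2 -> 0 < w -> C f w w) ->
  forall f x, 0 < x -> (exists y, qconj (x * c true) y) ->
  exists2 k, 0 < k & C f (k * x) k.
Proof.
move=> C_rot C_swap C_opp C_infty C_diag f x x_gt0 [y0 xy0].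
have [c' [dom c'2 c'M]] := tri_param_conjs.
(* The module a O + b O with its conjugates. Multiplication by a or by b exchanges it with O,
   because a^2, b^2 and a b are integral. *)
pose E1 x x' := exists r r' t t', [/\ qint r r', qint t t',
  x = c true * r + c false * t & x' = c' true * r' + c' false * t'].
have E1D u u' v v' : E1 u u' -> E1 v v' -> E1 (u + v) (u' + v').
  move=> [r [r' [t [t' [rr tt -> ->]]]]] [p [p' [q [q' [pp qq -> ->]]]]].
  exists (r + p), (r' + p'), (t + q), (t' + q').
  by split; [exact: quad_intD|exact: quad_intD|ring|ring].
have E1N u u' : E1 u u' -> E1 (- u) (- u').
  move=> [r [r' [t [t' [rr tt -> ->]]]]].
  exists (- r), (- r'), (- t), (- t').
  by split; [exact: quad_intN|exact: quad_intN|ring|ring].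
have q0 : qint 0 0 by exact: (quad_int_nat s 0).
have E1c g u u' : qint u u' -> E1 (c g * u) (c' g * u').
  move=> uu; case: g; [exists u, u', 0, 0|exists 0, 0, u, u'];
  by split=> //; ring.
have E0c g u u' : E1 u u' -> qint (c g * u) (c' g * u').
  move=> [r [r' [t [t' [rr tt -> ->]]]]].
  case: g; rewrite !mulrDr !mulrA.
    by apply: quad_intD; apply: (quad_intM s_sqr) => //; rewrite -!expr2.
  by apply: quad_intD; apply: (quad_intM s_sqr) => //; rewrite -?expr2 // ![c false * _]mulrC ![c' false * _]mulrC.
have E0sqr u u' : E1 u u' -> qint (u ^+ 2) (u' ^+ 2).
  move=> uu; have [r [r' [t [t' [rr tt e e']]]]] := uu.
  have -> : u ^+ 2 = (c true * u) * r + (c false * u) * t.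
    by transitivity (u * (c true * r + c false * t)); [rewrite -e expr2|ring].
  have -> : u' ^+ 2 = (c' true * u') * r' + (c' false * u') * t'.
    by transitivity (u' * (c' true * r' + c' false * t')); [rewrite -e' expr2|ring].
  by apply: quad_intD; apply: (quad_intM s_sqr) => //; exact: E0c.
pose J w1 w1' w2 w2' := qint w1 w1' /\ E1 w2 w2' \/ E1 w1 w1' /\ qint w2 w2'.
have J_sqr w1 w1' w2 w2' : J w1 w1' w2 w2' ->
    qint (w1 ^+ 2) (w1' ^+ 2) /\ qint (w2 ^+ 2) (w2' ^+ 2).
  by move=> [[h1 h2]|[h1 h2]]; split; try exact: E0sqr; exact: (quad_intM s_sqr).
have J_swap w1 w1' w2 w2' : J w1 w1' w2 w2' -> J w2 w2' w1 w1'.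
  by move=> [[h1 h2]|[h1 h2]]; [right|left].
(* This is x / b, written as a quotient of elements of the field; clearing its denominator k puts (k
   x, k) in [J]. *)
pose z := x * c true / c true ^+ 2.
have [y1 cy1] := c_sqr true.
have xz : x = c true * z by rewrite /z; field; rewrite gt_eqF.
have [z' [p [q [zE _]]]] : exists z', qconj z z'.
  exists (y0 * y1^-1); apply: (quad_conjM s_sqr xy0).
  by apply: (quad_conjV s_sqr s_irr cy1); rewrite expf_neq0 ?gt_eqF.
have [k k_gt0 kz] := quad_int_clear s_sqr p q.
rewrite -zE in kz; exists k%:R; first by rewrite ltr0n.
set kz' := k%:R * (ratr p - ratr q * s) in kz.
have Jx : J (k%:R * x) (c' true * kz') k%:R k%:R.
  right; split; last exact: quad_int_nat.
  rewrite (_ : k%:R * x = c true * (k%:R * z)); last by rewrite xz; ring.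
  exact: E1c.
apply: (@descent R c c' C J dom _ C_rot C_swap C_opp C_infty C_diag _ J_swap _ _ _
  f _ _ _ _ Jx); rewrite ?mulr_gt0 ?ltr0n //.
(* An element equal to its own conjugate is rational. *)
- move=> [e1 e0 e]; apply: c_irr.
  have [h1 _ _] := c'2 true; have [h0 _ _] := c'2 false; have [h _ _] := c'M.
  rewrite e1 in h1; rewrite e0 in h0; rewrite e in h.
  have [u eu] := quad_conj_id h1; have [v ev] := quad_conj_id h0.
  by have [w ew] := quad_conj_id h; exists u, v, w.
- move=> g w1 w1' w2 w2' [[h1 h2]|[h1 h2]]; [right|left]; split=> //.
    exact: quad_intD (E0c _ _ _ h2) (quad_intN h1).
  exact: E1D (E1c _ _ _ h2) (E1N _ _ h1).
- move=> w1 w1' w2 w2' [[h1 h2]|[h1 h2]]; [left|right]; split=> //.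
    exact: E1N.
  exact: quad_intN.
- move=> w1 w1' w2 w2' /J_sqr[[h _ _] _] w10.
  by rewrite -sqrf_eq0; apply: (quad_conj_neq0 s_irr h); rewrite sqrf_eq0.
- move=> w1 w1' w2 w2' /J_sqr[h1 h2].
  have h := quad_intM s_sqr h1 (quad_int_sym h2).
  have e1 : (w1 * w2') ^+ 2 + (w2 * w1') ^+ 2 =
    w1 ^+ 2 * w2' ^+ 2 + w1' ^+ 2 * w2 ^+ 2 by ring.
  have e2 : (w1 * w1' * (w2 * w2')) ^+ 2 =
    w1 ^+ 2 * w2' ^+ 2 * (w1' ^+ 2 * w2 ^+ 2) by ring.
  have [|T eT] := quad_int_trace h.
    by rewrite -e1 addr_ge0 // sqr_ge0.
  have [|N eN] := quad_int_norm s_sqr h.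
    by rewrite -e2 sqr_ge0.
  by exists T, N; rewrite e1 e2.
Qed.
End QuadraticDescent.

(** * Projective transformations and generated subgroups *)

Section Matrix2.
Variable F : fieldType.
Implicit Types (A B : 'M[F]_2).

Definition mx2 (a b c d : F) : 'M[F]_2 :=
  \matrix_(i, j) if i == 0 then if j == 0 then a else b
                 else if j == 0 then c else d.

Lemma mx2_00 a b c d : mx2 a b c d 0 0 = a. Proof. by rewrite mxE. Qed.
Lemma mx2_01 a b c d : mx2 a b c d 0 1 = b. Proof. by rewrite mxE. Qed.
Lemma mx2_10 a b c d : mx2 a b c d 1 0 = c. Proof. by rewrite mxE. Qed.
Lemma mx2_11 a b c d : mx2 a b c d 1 1 = d. Proof. by rewrite mxE. Qed.
Definition mx2E := (mx2_00, mx2_01, mx2_10, mx2_11).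

Lemma mx2_ext A B : A 0 0 = B 0 0 -> A 0 1 = B 0 1 -> A 1 0 = B 1 0 ->
  A 1 1 = B 1 1 -> A = B.
Proof.
move=> e00 e01 e10 e11; apply/matrixP => i j.
have H (k : 'I_2) : k = 0 \/ k = 1.
  by case: k => -[|[|//]] k2; [left|right]; exact: val_inj.
by case: (H i) => ->; case: (H j) => ->.
Qed.

Lemma mulmx2E A B i j : (A * B) i j = A i 0 * B 0 j + A i 1 * B 1 j.
Proof. by rewrite mxE big_ord_recl big_ord1; congr (_ + A i _ * B _ j); exact: val_inj. Qed.

Lemma mx2_1E : ((1 : 'M[F]_2) 0 0 = 1) * ((1 : 'M[F]_2) 0 1 = 0) *
  ((1 : 'M[F]_2) 1 0 = 0) * ((1 : 'M[F]_2) 1 1 = 1).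
Proof. by rewrite !mxE. Qed.

Lemma oppmx2E A i j : (- A) i j = - A i j.
Proof. by rewrite mxE. Qed.

Lemma det_mx2E A : \det A = A 0 0 * A 1 1 - A 0 1 * A 1 0.
Proof.
rewrite (expand_det_row _ 0) big_ord_recl big_ord1 /cofactor !det_mx11 !mxE /=.
rewrite expr0 expr1 mul1r mulN1r mulrN; congr (_ * A _ _ - A _ _ * A _ _); exact: val_inj.
Qed.

Lemma trace_mx2E A : \tr A = A 0 0 + A 1 1.
Proof.
by rewrite /mxtrace big_ord_recl big_ord1; congr (_ + A _ _); exact: val_inj.
Qed.

Lemma det_mul2 A B : \det (A * B) = \det A * \det B.
Proof. exact: det_mulmx. Qed.

Lemma unitmx2E A : (A \is a GRing.unit) = (\det A != 0).
Proof. by rewrite -unitfE -unitmxE. Qed.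

Lemma det_inv2 A : \det A^-1 = (\det A)^-1.
Proof. exact: det_inv. Qed.

Lemma inv_mx2E A : \det A != 0 ->
  A^-1 = mx2 (A 1 1 / \det A) (- A 0 1 / \det A) (- A 1 0 / \det A) (A 0 0 / \det A).
Proof.
move=> dA; have uA : A \is a GRing.unit by rewrite unitmx2E.
apply: (mulrI uA); rewrite divrr //.
have := dA; rewrite det_mx2E => dA'.
by apply: mx2_ext; rewrite mulmx2E !mx2E mx2_1E; field.
Qed.

End Matrix2.

Section ProjectiveLine.
Variable F : fieldType.
Implicit Types (A B : 'M[F]_2) (p q : P1 F).

Lemma hpoint_scale (k x y : F) : k != 0 -> hpoint (k * x) (k * y) = hpoint x y.
Proof.
move=> k0; rewrite /hpoint mulf_eq0 (negPf k0) /=.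
by case: eqVneq => // y0; congr Some; field; rewrite k0 y0.
Qed.

Lemma mobius_hpoint A (x y : F) : (x != 0) || (y != 0) ->
  mobius A (hpoint x y) = hpoint (A 0 0 * x + A 0 1 * y) (A 1 0 * x + A 1 1 * y).
Proof.
rewrite {1}/hpoint; case: (eqVneq y 0) => [->|y0 _].
  rewrite orbF => x0 /=; rewrite -(hpoint_scale _ _ x0).
  by rewrite !mulr0 !addr0 ![x * _]mulrC.
rewrite /= -(hpoint_scale _ _ y0).
by congr hpoint; field.
Qed.

Definition hx p : F := if p is Some x then x else 1.
Definition hy p : F := if p is Some x then 1 else 0.

Lemma hpoint_hxy p : hpoint (hx p) (hy p) = p.
Proof.
by case: p => [x|]; rewrite /hpoint /= ?eqxx // oner_eq0 divr1.
Qed.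

Lemma hxy_neq0 p : (hx p != 0) || (hy p != 0).
Proof. by case: p => [x|] /=; rewrite oner_neq0 ?orbT. Qed.

Lemma mobiusE A p :
  mobius A p = hpoint (A 0 0 * hx p + A 0 1 * hy p) (A 1 0 * hx p + A 1 1 * hy p).
Proof. by rewrite -{1}(hpoint_hxy p) mobius_hpoint // hxy_neq0. Qed.

Lemma mulmx2_neq0 A (x y : F) : \det A != 0 -> (x != 0) || (y != 0) ->
  (A 0 0 * x + A 0 1 * y != 0) || (A 1 0 * x + A 1 1 * y != 0).
Proof.
move=> dA; apply: contraTT; rewrite !negb_or !negbK => /andP[/eqP e0 /eqP e1].
have ex : \det A * x = 0.
  rewrite det_mx2E; transitivity (A 1 1 * (A 0 0 * x + A 0 1 * y) -
    A 0 1 * (A 1 0 * x + A 1 1 * y)); first by ring.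
  by rewrite e0 e1 !mulr0 subr0.
have ey : \det A * y = 0.
  rewrite det_mx2E; transitivity (A 0 0 * (A 1 0 * x + A 1 1 * y) -
    A 1 0 * (A 0 0 * x + A 0 1 * y)); first by ring.
  by rewrite e0 e1 !mulr0 subr0.
by move/eqP: ex; move/eqP: ey; rewrite !mulf_eq0 (negPf dA) /= => -> ->.
Qed.

Lemma mobiusM A B p : \det B != 0 -> mobius (A * B) p = mobius A (mobius B p).
Proof.
move=> dB; rewrite !(mobiusE _ p) mobius_hpoint ?mulmx2_neq0 ?hxy_neq0 //.
by rewrite !mulmx2E; congr hpoint; ring.
Qed.

Lemma mobius1 p : mobius 1 p = p.
Proof. by rewrite mobiusE !mx2_1E !mul1r !mul0r addr0 add0r hpoint_hxy. Qed.

Lemma mobiusK A : \det A != 0 -> cancel (mobius A) (mobius A^-1).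
Proof. by move=> dA p; rewrite -mobiusM // mulVr ?mobius1 // unitmx2E. Qed.

Lemma mobiusVK A : \det A != 0 -> cancel (mobius A^-1) (mobius A).
Proof.
by move=> dA p; rewrite -mobiusM ?det_inv2 ?invr_eq0 // mulrV ?mobius1 // unitmx2E.
Qed.

Lemma hdetE p q : hdet p q = hx p * hy q - hy p * hx q.
Proof. by case: p => [x|]; case: q => [y|] /=; ring. Qed.

Lemma hpoint_coords (x y : F) : (x != 0) || (y != 0) -> exists2 k, k != 0 &
  x = k * hx (hpoint x y) /\ y = k * hy (hpoint x y).
Proof.
rewrite /hpoint; case: (eqVneq y 0) => [->|y0 _].
  by rewrite orbF => x0; exists x; rewrite //= mulr1 mulr0.
by exists y => //=; rewrite mulr1 mulrC divfK.
Qed.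

(** A matrix carries standard coordinates to standard coordinates up to a factor depending on the
    point. Each point occurs once above and once below in a cross-ratio, so these factors cancel. *)
Lemma mobius_scale A : \det A != 0 -> exists m : P1 F -> F,
  (forall p, m p != 0) /\ forall p q,
  hdet (mobius A p) (mobius A q) = \det A * (m p * m q) * hdet p q.
Proof.
move=> dA.
have H p : exists k, k != 0 /\ (A 0 0 * hx p + A 0 1 * hy p = k^-1 * hx (mobius A p) /\
    A 1 0 * hx p + A 1 1 * hy p = k^-1 * hy (mobius A p)).
  have [k k0 e] := hpoint_coords (mulmx2_neq0 dA (hxy_neq0 p)).
  by exists k^-1; rewrite invr_eq0 k0 invrK mobiusE.
have [m mP] := choice H; exists m; split=> [p|p q]; first by case: (mP p).
have [p0 [px py]] := mP p; have [q0 [qx qy]] := mP q; rewrite !hdetE.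
transitivity ((m p * m q) * ((A 0 0 * hx p + A 0 1 * hy p) * (A 1 0 * hx q + A 1 1 * hy q)
  - (A 1 0 * hx p + A 1 1 * hy p) * (A 0 0 * hx q + A 0 1 * hy q))).
  by rewrite px py qx qy; field; rewrite p0 q0.
by rewrite det_mx2E; ring.
Qed.

Lemma cross_ratio_mobius A p1 p2 p3 p4 : \det A != 0 ->
  cross_ratio (mobius A p1) (mobius A p2) (mobius A p3) (mobius A p4) =
  cross_ratio p1 p2 p3 p4.
Proof.
move=> dA; have [m [m0 mE]] := mobius_scale dA; rewrite /cross_ratio !mE.
rewrite -[RHS](hpoint_scale (k := \det A ^+ 2 * (m p1 * m p2 * m p3 * m p4))).
  by congr hpoint; ring.
by rewrite !mulf_neq0 // expf_neq0.
Qed.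

Lemma CR_mobius A (X : set (P1 F)) : \det A != 0 ->
  CR [set p | X (mobius A p)] = CR X.
Proof.
move=> dA; have inj := can_inj (mobiusK dA).
have sz (f : P1 F -> P1 F) p1 p2 p3 p4 : injective f ->
    size (undup [:: f p1; f p2; f p3; f p4]) = size (undup [:: p1; p2; p3; p4]).
  move=> f_inj; have -> : [:: f p1; f p2; f p3; f p4] = map f [:: p1; p2; p3; p4] by [].
  by rewrite (undup_map_inj f_inj) size_map.
apply/seteqP; split=> c [p1 [p2 [p3 [p4 [[X1 X2] [X3 X4] s3 ->]]]]].
  exists (mobius A p1), (mobius A p2), (mobius A p3), (mobius A p4).
  by split=> //; rewrite ?sz ?cross_ratio_mobius.
exists (mobius A^-1 p1), (mobius A^-1 p2), (mobius A^-1 p3), (mobius A^-1 p4).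
split; rewrite /= ?mobiusVK //.
  by rewrite sz //; exact: can_inj (mobiusVK dA).
by rewrite cross_ratio_mobius // det_inv2 invr_eq0.
Qed.

End ProjectiveLine.

Section Generation.
Variable R : realType.
Implicit Types (X G : set 'M[R]_2) (g h : 'M[R]_2).

Lemma divr_closedP G : GRing.divr_closed [in G] <->
  G 1 /\ forall g h, G g -> G h -> G (g / h).
Proof.
split=> [[G1 GM]|[G1 GM]].
  split=> [|g h Gg Gh]; first by move: G1; rewrite inE.
  by have := GM g h; rewrite !inE; apply.
by split=> [|g h]; rewrite ?inE // => Gg Gh; exact: GM.
Qed.

Lemma psubgroup_min X G : GRing.divr_closed [in G] -> X `<=` G -> G (- 1) ->
  psubgroup_gen X `<=` G.
Proof. by move=> Gdiv XG GN1; apply: smallest_sub => // g [/XG|->]. Qed.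

Lemma psubgroup_sub X g : X g -> psubgroup_gen X g.
Proof. by move=> Xg G [_]; apply; left. Qed.

Lemma psubgroupN1 X : psubgroup_gen X (- 1).
Proof. by move=> G [_]; apply; right. Qed.

Lemma psubgroup_divr X : GRing.divr_closed [in psubgroup_gen X].
Proof.
apply/divr_closedP; split=> [|g h Xg Xh] G GX; have [/divr_closedP[G1 GM] _] := GX.
  exact: G1.
by apply: GM; [exact: Xg|exact: Xh].
Qed.

Lemma psubgroup1 X : psubgroup_gen X 1.
Proof. by have /divr_closedP[] := @psubgroup_divr X. Qed.

Lemma psubgroup_div X g h :
  psubgroup_gen X g -> psubgroup_gen X h -> psubgroup_gen X (g / h).
Proof. by have /divr_closedP[_] := @psubgroup_divr X; apply. Qed.

Lemma psubgroupV X g : psubgroup_gen X g -> psubgroup_gen X g^-1.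
Proof. by move=> Xg; rewrite -[g^-1]mul1r; apply: psubgroup_div => //; exact: psubgroup1. Qed.

Lemma psubgroupM X g h :
  psubgroup_gen X g -> psubgroup_gen X h -> psubgroup_gen X (g * h).
Proof. by move=> Xg Xh; rewrite -[h]invrK; apply: psubgroup_div => //; exact: psubgroupV. Qed.

Lemma psubgroupN X g : psubgroup_gen X g -> psubgroup_gen X (- g).
Proof. by move=> Xg; rewrite -mulN1r; apply: psubgroupM => //; exact: psubgroupN1. Qed.

Lemma psubgroup_subset X Y : X `<=` psubgroup_gen Y ->
  psubgroup_gen X `<=` psubgroup_gen Y.
Proof.
by move=> XY; apply: psubgroup_min => //; [exact: psubgroup_divr|exact: psubgroupN1].
Qed.

Definition conjm h g := h * g * h^-1.

Lemma conjmK h g : \det h != 0 -> conjm h^-1 (conjm h g) = g.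
Proof.
rewrite -unitmx2E /conjm => uh.
by rewrite invrK !mulrA mulVr // mul1r -mulrA mulVr // mulr1.
Qed.

Lemma conjmVK h g : \det h != 0 -> conjm h (conjm h^-1 g) = g.
Proof. by move=> dh; rewrite -{1}[h]invrK conjmK // det_inv2 invr_eq0. Qed.

Lemma conjmM h g g' : \det h != 0 -> conjm h (g * g') = conjm h g * conjm h g'.
Proof.
rewrite -unitmx2E /conjm => uh.
by rewrite !mulrA -[h * g / h * h]mulrA mulVr // mulr1.
Qed.

Lemma conjm1 h : \det h != 0 -> conjm h 1 = 1.
Proof. by rewrite -unitmx2E /conjm => uh; rewrite mulr1 divrr. Qed.

Lemma conjmN h g : conjm h (- g) = - conjm h g.
Proof. by rewrite /conjm mulrN mulNr. Qed.

Lemma det_conjm h g : \det h != 0 -> \det (conjm h g) = \det g.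
Proof.
move=> dh; rewrite /conjm !det_mul2 det_inv2 mulrC mulrA mulVf //; exact: mul1r.
Qed.

Lemma trace_conjm h g : \det h != 0 -> \tr (conjm h g) = \tr g.
Proof.
rewrite -unitmx2E /conjm => uh.
by rewrite -[_ * _ * _]/(h *m g *m h^-1) mxtrace_mulC mulmxA -[h^-1 *m h]/(h^-1 * h) mulVr // mul1mx.
Qed.

(* Inverses are total in the matrix ring, so invertibility has to be carried along. *)
Lemma psubgroup_conjm h X g : \det h != 0 -> (forall x, X x -> \det x != 0) ->
  psubgroup_gen X g -> psubgroup_gen [set conjm h x | x in X] (conjm h g).
Proof.
move=> dh Xdet; pose G := [set g | \det g != 0 /\
  psubgroup_gen [set conjm h x | x in X] (conjm h g)].
have N1 : \det (- 1 : 'M[R]_2) != 0.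
  by rewrite -unitmx2E unitrN1.
suff : psubgroup_gen X `<=` G by move=> XG /XG[].
apply: psubgroup_min.
- apply/divr_closedP; split; first by split; rewrite ?det1 ?oner_neq0 // conjm1 //; exact: psubgroup1.
  move=> x y [dx Xx] [dy Xy]; split.
    by rewrite det_mul2 det_inv2 mulf_neq0 // invr_eq0.
  have -> : conjm h (x / y) = conjm h x / conjm h y.
    have uy : conjm h y \is a GRing.unit by rewrite unitmx2E det_conjm.
    apply: (mulIr uy); rewrite divrK // -conjmM // divrK // unitmx2E //.
  exact: psubgroup_div.
- by move=> x Xx; split; [exact: Xdet|apply: psubgroup_sub; exists x].
- by split=> //; rewrite conjmN conjm1 //; exact: psubgroupN1.
Qed.

Lemma squares_conjm h (G : set 'M[R]_2) g : \det h != 0 -> (forall x, G x -> \det x != 0) ->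
  squares_subgroup G g -> squares_subgroup [set conjm h x | x in G] (conjm h g).
Proof.
move=> dh Gdet /(psubgroup_conjm dh) H.
have {}H : psubgroup_gen [set conjm h x | x in [set g * g | g in G]] (conjm h g).
  by apply: H => x [y Gy <-]; rewrite det_mul2 mulf_neq0 ?Gdet.
move: H; apply: psubgroup_subset => _ [_ [y Gy <-] <-].
by apply: psubgroup_sub; exists (conjm h y); [exists y|rewrite conjmM].
Qed.

Lemma invariant_trace_field_conjm h (G : set 'M[R]_2) :
  \det h != 0 -> (forall x, G x -> \det x != 0) ->
  invariant_trace_field [set conjm h x | x in G] = invariant_trace_field G.
Proof.
move=> dh Gdet; rewrite /invariant_trace_field; congr subfield_gen.
have dh' : \det h^-1 != 0 by rewrite det_inv2 invr_eq0.
apply/seteqP; split=> _ [g Gg <-]; last first.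
  by exists (conjm h g); [exact: squares_conjm|rewrite trace_conjm].
exists (conjm h^-1 g); last by rewrite trace_conjm.
have := squares_conjm dh' _ Gg.
have -> : [set conjm h^-1 x | x in [set conjm h x | x in G]] = G.
  apply/seteqP; split=> x; first by move=> [_ [y Gy <-] <-]; rewrite conjmK.
  by move=> Gx; exists (conjm h x); [exists x|rewrite conjmK].
by apply=> x [y Gy <-]; rewrite det_conjm // Gdet.
Qed.

Lemma cusps_conjm h (G : set 'M[R]_2) :
  \det h != 0 -> (forall x, G x -> \det x != 0) ->
  cusps G = [set p | cusps [set conjm h x | x in G] (mobius h p)].
Proof.
move=> dh Gdet; have par g : parabolic g -> parabolic (conjm h g).
  move=> [g1 gN1 tr2]; split; rewrite ?trace_conjm //.
    by move=> e; apply: g1; rewrite -(conjmK g dh) e conjm1 // det_inv2 invr_eq0.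
  by move=> e; apply: gN1; rewrite -(conjmK g dh) e conjmN conjm1 // det_inv2 invr_eq0.
have par' g : parabolic (conjm h g) -> parabolic g.
  move=> [g1 gN1 tr2]; split; last by rewrite -(trace_conjm g dh).
    by move=> e; apply: g1; rewrite e conjm1.
  by move=> e; apply: gN1; rewrite e conjmN conjm1.
have fix_h g p : G g -> mobius (conjm h g) (mobius h p) = mobius h (mobius g p).
  move=> Gg; have e : conjm h g * h = h * g by rewrite /conjm divrK // unitmx2E.
  by rewrite -mobiusM // e mobiusM // Gdet.
apply/seteqP; split=> p.
  move=> [g Gg [gpar gp]]; exists (conjm h g); first by exists g.
  by rewrite fix_h // gp; split=> //; exact: par.
move=> [_ [g Gg <-] [gpar gp]]; exists g => //; split; first exact: par'.
by apply: (can_inj (mobiusK dh)); rewrite -fix_h.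
Qed.

End Generation.

(** * The triangle group in normal form *)

(** Completing the square: if u is irrational and u^2 = p + q u, then s = u - q / 2 has the rational
    square p + q^2 / 4. *)
Lemma rat_degree2 (R : realType) (K : set R) : rat_degree K 2 ->
  exists (s : R) (d : rat), [/\ s ^+ 2 = ratr d, forall q : rat, s <> ratr q &
    forall x, K x <-> exists p q : rat, x = ratr p + ratr q * s].
Proof.
move=> [L [f [<- dimL]]].
have fA (q : rat) : f q%:A = ratr q.
  exact: (fmorph_eq_rat (f \o in_alg L)).
have [u uF] : exists u : L, u \notin 1%VS.
  apply: contrapT => /forallNP H.
  have : ({:L} <= 1)%VS by apply/subvP => x _; have /negP/negbNE := H x.
  by move=> /dimvS; rewrite dimL dimv1.
have span1 (v : L) : v \notin 1%VS -> forall x, exists p q : rat, x = p%:A + q *: v.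
  move=> vF x.
  have dv : (\dim (1 + <[v]>)%VS = 2)%N.
    rewrite dimv_disjoint_sum ?dimv1 ?dim_vline.
      by case: eqP vF => // ->; rewrite mem0v.
    apply/eqP; rewrite -subv0; apply/subvP => y.
    rewrite memv_cap => /andP[/vlineP[p ->] /vlineP[q e]].
    have [q0|q0] := eqVneq q 0; first by rewrite e q0 scale0r mem0v.
    case/negP: vF; apply/vlineP; exists (p / q).
    by rewrite mulrC -scalerA e scalerA mulVf // scale1r.
  have : (1 + <[v]>)%VS = {:L}%VS.
    by apply/eqP; rewrite eqEdim subvf dimL dv.
  move=> e; have : x \in (1 + <[v]>)%VS by rewrite e memvf.
  move=> /memv_addP[_ /vlineP[p ->] [_ /vlineP[q ->] ->]].
  by exists p, q.
have [p [q uu]] := span1 u uF (u * u).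
pose v := u - (q / 2)%:A.
have vF : v \notin 1%VS.
  apply: contraNN uF => vF; rewrite -(subrK (q / 2)%:A u) rpredD //.
  by rewrite rpredZ // mem1v.
exists (f v), (p + q ^+ 2 / 4); split.
- rewrite /v rmorphB rmorphD /= fA.
  have : f (u * u) = ratr p + ratr q * f u.
    by rewrite uu rmorphD /= fA -mulr_algl rmorphM /= fA.
  rewrite rmorphM => e; rewrite expr2 mulrBr mulrBl e.
  by rewrite !fmorph_div rmorphXn /= !ratr_nat; field.
- move=> r; rewrite -fA => /fmorph_inj vr.
  by case/negP: vF; rewrite vr rpredZ // mem1v.
move=> x; split=> [[y _ <-]|[r [t ->]]].
  have [r [t ->]] := span1 v vF y; exists r, t.
  by rewrite rmorphD /= fA -mulr_algl rmorphM /= fA.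
by exists (r%:A + t *: v) => //; rewrite rmorphD /= fA -mulr_algl rmorphM /= fA.
Qed.

Section NormalForm.
Variables (R : realType) (a b : R).
Hypothesis b_gt0 : 0 < b.

(** The mirrors are the lines Re z = b / 2, Re z = - a / 2 and the unit circle. *)
Definition tri_gens : set 'M[R]_2 :=
  [set mx2 (-1) b 0 1; mx2 (-1) (- a) 0 1; mx2 0 1 1 0].
Local Notation G := (psubgroup_gen tri_gens).
Definition tri_group : set 'M[R]_2 := [set g | G g /\ \det g = 1].

Lemma divring_closedP (K : set R) : GRing.divring_closed [in K] <->
  [/\ K 1, forall x y, K x -> K y -> K (x - y) & forall x y, K x -> K y -> K (x / y)].
Proof.
split=> [[K1 KB KM]|[K1 KB KM]].
  split=> [|x y Kx Ky|x y Kx Ky].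
  - by move: K1; rewrite inE.
  - by have := KB x y; rewrite !inE; apply.
  - by have := KM x y; rewrite !inE; apply.
by split=> [|x y|x y]; rewrite ?inE //= => Kx Ky; [exact: KB|exact: KM].
Qed.

Section Graded.
Variable K : set R.
Hypothesis K_div : GRing.divring_closed [in K].

Lemma divring1 : K 1. Proof. by have /divring_closedP[] := K_div. Qed.
Lemma divringB x y : K x -> K y -> K (x - y).
Proof. by have /divring_closedP[_ H _] := K_div; exact: H. Qed.
Lemma divring_div x y : K x -> K y -> K (x / y).
Proof. by have /divring_closedP[_ _ H] := K_div; exact: H. Qed.
Lemma divring0 : K 0.
Proof. by rewrite -(subrr 1); apply: divringB; exact: divring1. Qed.
Lemma divringN x : K x -> K (- x).
Proof. by move=> Kx; rewrite -sub0r; apply: divringB => //; exact: divring0. Qed.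
Lemma divringD x y : K x -> K y -> K (x + y).
Proof. by move=> Kx Ky; rewrite -[y]opprK; apply: divringB => //; exact: divringN. Qed.
Lemma divringV x : K x -> K x^-1.
Proof. by move=> Kx; rewrite -[x^-1]mul1r; apply: divring_div => //; exact: divring1. Qed.
Lemma divringM x y : K x -> K y -> K (x * y).
Proof. by move=> Kx Ky; rewrite -[y]invrK; apply: divring_div => //; exact: divringV. Qed.
Lemma divring_nat n : K n%:R.
Proof.
elim: n => [|n IHn]; first exact: divring0.
by rewrite mulrSr; apply: divringD => //; exact: divring1.
Qed.

Hypotheses (K_bb : K (b ^+ 2)) (K_ab : K (a * b)).

(* This is the line [b K], as [b ^+ 2] is in [K]. *)
Definition oddK x := K (x * b).

Lemma oddK_mul x y : oddK x -> oddK y -> K (x * y).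
Proof.
move=> Kx Ky; have -> : x * y = (x * b) * (y * b) / b ^+ 2.
  by field; rewrite gt_eqF.
by apply: divring_div => //; exact: divringM.
Qed.

Lemma oddKMr x y : K x -> oddK y -> oddK (x * y).
Proof. by rewrite /oddK => Kx Ky; rewrite -mulrA; exact: divringM. Qed.

Lemma oddKMl x y : oddK x -> K y -> oddK (x * y).
Proof. by move=> Kx Ky; rewrite mulrC; exact: oddKMr. Qed.

Lemma oddKD x y : oddK x -> oddK y -> oddK (x + y).
Proof. by rewrite /oddK mulrDl; exact: divringD. Qed.

Lemma oddKN x : oddK x -> oddK (- x).
Proof. by rewrite /oddK mulNr; exact: divringN. Qed.

Lemma oddK0 : oddK 0.
Proof. by rewrite /oddK mul0r; exact: divring0. Qed.

(** Reflections in the two lines are even, the one in the unit circle is odd, and parities add under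
    products. An odd element has its trace in b K, but every square is even, which puts the traces
    of the squares subgroup in K. *)
Definition even_mx (g : 'M[R]_2) :=
  [/\ K (g 0 0), oddK (g 0 1), oddK (g 1 0) & K (g 1 1)].
Definition odd_mx (g : 'M[R]_2) :=
  [/\ oddK (g 0 0), K (g 0 1), K (g 1 0) & oddK (g 1 1)].
Definition det_sign (g : 'M[R]_2) := \det g = 1 \/ \det g = - 1.

Lemma even_mxM g h : even_mx g -> even_mx h -> even_mx (g * h).
Proof.
move=> [g1 g2 g3 g4] [h1 h2 h3 h4]; split; rewrite mulmx2E.
- by apply: divringD; [exact: divringM|exact: oddK_mul].
- by apply: oddKD; [exact: oddKMr|exact: oddKMl].
- by apply: oddKD; [exact: oddKMl|exact: oddKMr].
- by apply: divringD; [exact: oddK_mul|exact: divringM].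
Qed.

Lemma odd_mxM g h : odd_mx g -> odd_mx h -> even_mx (g * h).
Proof.
move=> [g1 g2 g3 g4] [h1 h2 h3 h4]; split; rewrite mulmx2E.
- by apply: divringD; [exact: oddK_mul|exact: divringM].
- by apply: oddKD; [exact: oddKMl|exact: oddKMr].
- by apply: oddKD; [exact: oddKMr|exact: oddKMl].
- by apply: divringD; [exact: divringM|exact: oddK_mul].
Qed.

Lemma even_odd_mxM g h : even_mx g -> odd_mx h -> odd_mx (g * h).
Proof.
move=> [g1 g2 g3 g4] [h1 h2 h3 h4]; split; rewrite mulmx2E.
- by apply: oddKD; [exact: oddKMr|exact: oddKMl].
- by apply: divringD; [exact: divringM|exact: oddK_mul].
- by apply: divringD; [exact: oddK_mul|exact: divringM].
- by apply: oddKD; [exact: oddKMl|exact: oddKMr].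
Qed.

Lemma odd_even_mxM g h : odd_mx g -> even_mx h -> odd_mx (g * h).
Proof.
move=> [g1 g2 g3 g4] [h1 h2 h3 h4]; split; rewrite mulmx2E.
- by apply: oddKD; [exact: oddKMl|exact: oddKMr].
- by apply: divringD; [exact: oddK_mul|exact: divringM].
- by apply: divringD; [exact: divringM|exact: oddK_mul].
- by apply: oddKD; [exact: oddKMr|exact: oddKMl].
Qed.

Lemma det_sign_neq0 g : det_sign g -> \det g != 0.
Proof. by case=> ->; rewrite ?oppr_eq0 oner_neq0. Qed.

Lemma det_sign_div g h : det_sign g -> det_sign h -> det_sign (g / h).
Proof.
rewrite /det_sign det_mul2 det_inv2.
by case=> -> [] ->; rewrite ?invrN ?invr1 ?mulrN ?mulr1 ?opprK; [left|right|right|left].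
Qed.

Lemma det_sign_inv g : det_sign g ->
  g^-1 = mx2 (g 1 1) (- g 0 1) (- g 1 0) (g 0 0) \/
  g^-1 = mx2 (- g 1 1) (g 0 1) (g 1 0) (- g 0 0).
Proof.
move=> dg; rewrite inv_mx2E ?det_sign_neq0 //; case: dg => ->.
  by left; rewrite !divr1.
by right; rewrite invrN1 !mulrN1 !opprK.
Qed.

Lemma even_mxV g : det_sign g -> even_mx g -> even_mx g^-1.
Proof.
move=> /det_sign_inv gV [g1 g2 g3 g4].
by case: gV => ->; split; rewrite mx2E //; try exact: divringN; exact: oddKN.
Qed.

Lemma odd_mxV g : det_sign g -> odd_mx g -> odd_mx g^-1.
Proof.
move=> /det_sign_inv gV [g1 g2 g3 g4].
by case: gV => ->; split; rewrite mx2E //; try exact: oddKN; exact: divringN.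
Qed.

Lemma even_mx1 : even_mx 1.
Proof. by split; rewrite mx2_1E; try exact: oddK0; exact: divring1. Qed.

Lemma even_mxN1 : even_mx (- 1).
Proof.
split; rewrite oppmx2E mx2_1E ?oppr0; try exact: oddK0;
by apply: divringN; exact: divring1.
Qed.

Lemma det_mxN1 : \det (- 1 : 'M[R]_2) = 1.
Proof. by rewrite det_mx2E !oppmx2E !mx2_1E; ring. Qed.

Lemma tri_gens_graded g : G g -> det_sign g /\ (even_mx g \/ odd_mx g).
Proof.
apply: (@psubgroup_min _ _ [set g | det_sign g /\ (even_mx g \/ odd_mx g)]).
- apply/divr_closedP; split.
    by split; [left; exact: det1|left; exact: even_mx1].
  move=> x y [dx gx] [dy gy]; split; first exact: det_sign_div.
  have {}gy : even_mx y^-1 \/ odd_mx y^-1.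
    by case: gy => gy; [left; exact: even_mxV|right; exact: odd_mxV].
  case: gx gy => gx [] gy; [left|right|right|left].
  - exact: even_mxM.
  - exact: even_odd_mxM.
  - exact: odd_even_mxM.
  - exact: odd_mxM.
- move=> _ [[|]|] ->; (split; first by rewrite /det_sign det_mx2E !mx2E; (left; ring) || (right; ring)).
  + left; split; rewrite mx2E; rewrite /oddK ?mul0r -?expr2 //;
    [apply: divringN; exact: divring1|exact: divring0|exact: divring1].
  + left; split; rewrite mx2E; rewrite /oddK ?mul0r ?mulNr; try exact: divringN;
    [apply: divringN; exact: divring1|exact: divring0|exact: divring1].
  + by right; split; rewrite mx2E; try exact: divring1; exact: oddK0.
- by split; [left; exact: det_mxN1|left; exact: even_mxN1].
Qed.

Lemma squares_even g : squares_subgroup tri_group g -> even_mx g.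
Proof.
suff : squares_subgroup tri_group `<=` [set g | det_sign g /\ even_mx g] by move=> H /H[].
apply: psubgroup_min.
- apply/divr_closedP; split; first by split; [left; exact: det1|exact: even_mx1].
  move=> x y [dx gx] [dy gy]; split; first exact: det_sign_div.
  by apply: even_mxM => //; exact: even_mxV.
- move=> _ [x [/tri_gens_graded[_ gx] dx] <-]; split.
    by left; rewrite det_mul2 dx mulr1.
  by case: gx => gx; [exact: even_mxM|exact: odd_mxM].
- by split; [left; exact: det_mxN1|exact: even_mxN1].
Qed.

Lemma invariant_trace_field_sub : invariant_trace_field tri_group `<=` K.
Proof.
apply: smallest_sub => // _ [g /squares_even[g1 _ _ g4] <-].
by rewrite trace_mx2E; exact: divringD.
Qed.

Lemma cusps_odd z : cusps tri_group (Some z) -> oddK z.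
Proof.
move=> [g [/tri_gens_graded[_ gr] dg] [[g1 gN1 tr] gz]].
have tr4 : (g 0 0 + g 1 1) ^+ 2 = 4.
  by rewrite -trace_mx2E -real_normK ?num_real // tr; ring.
move: dg; rewrite det_mx2E => dg.
have [g10|g10] := eqVneq (g 1 0) 0; last first.
  (* The fixed point equation has discriminant tr^2 - 4 det = 0, so z is its double root. In either
     parity this is a quotient of an element of K and one of b K. *)
  have -> : z = (g 0 0 - g 1 1) / (2 * g 1 0).
    move: gz; rewrite /= /hpoint; case: eqVneq => // w [] e.
    have {}e : g 0 0 * z + g 0 1 = z * (g 1 0 * z + g 1 1) by rewrite -[LHS](divfK w) e.
    have : (2 * g 1 0 * z - (g 0 0 - g 1 1)) ^+ 2 = 0.
      transitivity ((g 0 0 + g 1 1) ^+ 2 - 4 * (g 0 0 * g 1 1 - g 0 1 * g 1 0)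
        + 4 * g 1 0 * (z * (g 1 0 * z + g 1 1) - (g 0 0 * z + g 0 1))); first by ring.
      by rewrite tr4 dg e; ring.
    move=> /eqP; rewrite sqrf_eq0 subr_eq0 => /eqP <-.
    by field; rewrite g10.
  case: gr => -[e1 e2 e3 e4].
    have -> : (g 0 0 - g 1 1) / (2 * g 1 0) =
      (g 0 0 - g 1 1) / (2 * (g 1 0 * b)) * b.
      by field; rewrite g10 gt_eqF.
    apply: oddKMr; last by rewrite /oddK -expr2.
    apply: divring_div; first exact: divringB.
    by apply: divringM => //; exact: (divring_nat 2).
  rewrite /oddK mulrAC; apply: divring_div.
    by rewrite mulrBl; exact: divringB.
  by apply: divringM => //; exact: (divring_nat 2).
(* Here g fixes infinity as well as z; a parabolic element with two fixed points would be 1 or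
   -1. *)
have dg1 : g 0 0 * g 1 1 = 1 by move: dg; rewrite g10 mulr0 subr0.
have e11 : g 1 1 = g 0 0.
  have : (g 0 0 - g 1 1) ^+ 2 = 0.
    transitivity ((g 0 0 + g 1 1) ^+ 2 - 4 * (g 0 0 * g 1 1)); first by ring.
    by rewrite tr4 dg1; ring.
  by move=> /eqP; rewrite sqrf_eq0 subr_eq0 => /eqP.
have g00 : g 0 0 != 0 by apply/eqP => e; move/eqP: dg1; rewrite e mul0r eq_sym oner_eq0.
have g01 : g 0 1 = 0.
  move: gz; rewrite /= /hpoint g10 mul0r add0r e11 (negPf g00) => -[] /eqP.
  by rewrite mulrDl mulrAC divff // mul1r -subr_eq0 addrAC subrr add0r mulf_eq0 invr_eq0 (negPf g00) orbF => /eqP.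
have : (g 0 0 == 1) || (g 0 0 == - 1) by rewrite -sqrf_eq1 expr2 -{2}e11 dg1.
case/orP => /eqP e.
  by case: g1; apply: mx2_ext; rewrite mx2_1E ?e11.
by case: gN1; apply: mx2_ext; rewrite oppmx2E mx2_1E ?oppr0 ?e11.
Qed.

End Graded.
End NormalForm.

Section NormalFormCusps.
Variables (R : realType) (a b : R).
Hypotheses (b_gt0 : 0 < b) (a_ge0 : 0 <= a).
Local Notation G := (psubgroup_gen (tri_gens a b)).
Local Notation Gamma := (tri_group a b).

Let n1 : 'M[R]_2 := mx2 (-1) b 0 1.
Let n2 : 'M[R]_2 := mx2 (-1) (- a) 0 1.
Let n3 : 'M[R]_2 := mx2 0 1 1 0.

Let G1 : G n1. Proof. by apply: psubgroup_sub; left; left. Qed.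
Let G2 : G n2. Proof. by apply: psubgroup_sub; left; right. Qed.
Let G3 : G n3. Proof. by apply: psubgroup_sub; right. Qed.

(** [X] and [Y] turn around the two vertices other than infinity, with traces - a and b; they
    realise the rotations of the descent. *)
Let X : 'M[R]_2 := n2 * n3.
Let Y : 'M[R]_2 := n1 * n3.

Let XE : X = mx2 (- a) (-1) 1 0.
Proof. by apply: mx2_ext; rewrite mulmx2E !mx2E; ring. Qed.
Let YE : Y = mx2 b (-1) 1 0.
Proof. by apply: mx2_ext; rewrite mulmx2E !mx2E; ring. Qed.
Let GX : Gamma X.
Proof. by split; [exact: psubgroupM|rewrite XE det_mx2E !mx2E; ring]. Qed.
Let GY : Gamma Y.
Proof. by split; [exact: psubgroupM|rewrite YE det_mx2E !mx2E; ring]. Qed.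

Lemma invariant_trace_field_div : GRing.divring_closed [in invariant_trace_field Gamma].
Proof.
apply/divring_closedP; split=> [|x y Kx Ky|x y Kx Ky] K KX;
  have [/divring_closedP[K1 KB KM] _] := KX.
- exact: K1.
- by apply: KB; [exact: Kx|exact: Ky].
- by apply: KM; [exact: Kx|exact: Ky].
Qed.

Lemma invariant_trace_field_gens :
  [/\ invariant_trace_field Gamma (a ^+ 2), invariant_trace_field Gamma (b ^+ 2)
    & invariant_trace_field Gamma (a * b)].
Proof.
have Kdiv := invariant_trace_field_div.
have tr g : squares_subgroup Gamma g -> invariant_trace_field Gamma (\tr g).
  by move=> Gg; apply: sub_gen_smallest; exists g.
have SX : squares_subgroup Gamma (X * X) by apply: psubgroup_sub; exists X.
have SY : squares_subgroup Gamma (Y * Y) by apply: psubgroup_sub; exists Y.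
have Kn n := divring_nat Kdiv n.
have Kaa : invariant_trace_field Gamma (a ^+ 2).
  have -> : a ^+ 2 = \tr (X * X) + 2%:R.
    by rewrite XE trace_mx2E !mulmx2E !mx2E; ring.
  by apply: (divringD Kdiv); [exact: tr|exact: Kn].
have Kbb : invariant_trace_field Gamma (b ^+ 2).
  have -> : b ^+ 2 = \tr (Y * Y) + 2%:R.
    by rewrite YE trace_mx2E !mulmx2E !mx2E; ring.
  by apply: (divringD Kdiv); [exact: tr|exact: Kn].
split=> //.
(* The trace of X^2 Y^2 is (a^2 - 1)(b^2 - 1) + 2 a b + 1. *)
have -> : a * b = (\tr (X * X * (Y * Y)) - (a ^+ 2 - 1) * (b ^+ 2 - 1) - 1%:R) / 2%:R.
  by rewrite XE YE trace_mx2E !mulmx2E !mx2E; field.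
have K1 := divring1 Kdiv.
have KB := divringB Kdiv.
apply: (divring_div Kdiv); last exact: Kn.
apply: (KB); last exact: Kn.
apply: (KB); first by apply: tr; exact: psubgroupM.
by apply: (divringM Kdiv); exact: (KB).
Qed.

(** Elements of determinant -1 are allowed: conjugation by them preserves determinant and trace, so
    the full reflection group permutes the cusps of its orientation-preserving subgroup. *)
Lemma cusp_mobius g p : G g -> cusps Gamma p -> cusps Gamma (mobius g p).
Proof.
move=> Gg [h [Gh dh] [[h1 hN1 tr] hp]].
have [Kaa Kbb Kab] := invariant_trace_field_gens.
have [dg _] := tri_gens_graded b_gt0 invariant_trace_field_div Kbb Kab Gg.
have {}dg := det_sign_neq0 dg.
exists (conjm g h).
  split; last by rewrite det_conjm.
  by apply: psubgroup_div => //; exact: psubgroupM.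
split; first split.
- by move=> e; apply: h1; rewrite -(conjmK h dg) e conjm1 // det_inv2 invr_eq0.
- by move=> e; apply: hN1; rewrite -(conjmK h dg) e conjmN conjm1 // det_inv2 invr_eq0.
- by rewrite trace_conjm.
have dh0 : \det h != 0 by rewrite dh oner_neq0.
have e : conjm g h * g = g * h by rewrite /conjm divrK // unitmx2E.
by rewrite -mobiusM // e mobiusM // hp.
Qed.

Lemma cusp_infty : cusps Gamma None.
Proof.
have e : n2 * n1 = mx2 1 (- b - a) 0 1 :> 'M[R]_2.
  by apply: mx2_ext; rewrite mulmx2E !mx2E; ring.
exists (n2 * n1); first by split; [exact: psubgroupM|rewrite e det_mx2E !mx2E; ring].
rewrite e; split; last by rewrite /= /hpoint !mx2E eqxx.
split.
- by move=> /(congr1 (fun g : 'M[R]_2 => g 0 1)); rewrite /= mx2E mx2_1E => /eqP; rewrite -opprD oppr_eq0 gt_eqF // ltr_wpDr.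
- by move=> /(congr1 (fun g : 'M[R]_2 => g 0 0)); rewrite /= mx2E oppmx2E mx2_1E => /eqP; rewrite -subr_eq0 opprK -[1 + 1]/(2%:R) pnatr_eq0.
- by rewrite trace_mx2E !mx2E -[1 + 1]/(2%:R) normr_nat.
Qed.

Lemma cusp_mulmx g (x y : R) : G g -> cusps Gamma (hpoint x y) ->
  cusps Gamma (hpoint (g 0 0 * x + g 0 1 * y) (g 1 0 * x + g 1 1 * y)).
Proof.
move=> Gg; have [xy0|] := boolP ((x != 0) || (y != 0)).
  by rewrite -mobius_hpoint //; exact: cusp_mobius.
(* The pair (0, 0) is sent to infinity by [hpoint], which is a cusp anyway. *)
rewrite negb_or !negbK => /andP[/eqP -> /eqP ->] _.
by rewrite !mulr0 addr0 /hpoint eqxx; exact: cusp_infty.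
Qed.

Lemma cusp_vertex_b : b = 2 -> cusps Gamma (Some 1).
Proof.
move=> b2; exists Y => //; rewrite YE; split; last first.
  by rewrite /= /hpoint !mx2E mulr1 addr0 oner_eq0 divr1 b2; congr Some; ring.
split.
- by move=> /(congr1 (fun g : 'M[R]_2 => g 1 0)); rewrite /= mx2E mx2_1E => /eqP; rewrite ?oppr0 oner_eq0.
- by move=> /(congr1 (fun g : 'M[R]_2 => g 1 0)); rewrite /= mx2E oppmx2E mx2_1E => /eqP; rewrite ?oppr0 oner_eq0.
- by rewrite trace_mx2E !mx2E b2 addr0 normr_nat.
Qed.

Lemma cusp_vertex_a : a = 2 -> cusps Gamma (Some (- 1)).
Proof.
move=> a2; exists X => //; rewrite XE; split; last first.
  by rewrite /= /hpoint !mx2E addr0 mul1r oppr_eq0 oner_eq0 a2; congr Some; field.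
split.
- by move=> /(congr1 (fun g : 'M[R]_2 => g 1 0)); rewrite /= mx2E mx2_1E => /eqP; rewrite ?oppr0 oner_eq0.
- by move=> /(congr1 (fun g : 'M[R]_2 => g 1 0)); rewrite /= mx2E oppmx2E mx2_1E => /eqP; rewrite ?oppr0 oner_eq0.
- by rewrite trace_mx2E !mx2E a2 addr0 normrN normr_nat.
Qed.

Hypotheses (a_param : tri_param a) (b_param : tri_param b).
Hypothesis quad : rat_degree (invariant_trace_field Gamma) 2.

Lemma odd_cusps z : oddK b (invariant_trace_field Gamma) z -> cusps Gamma (Some z).
Proof.
move=> Kz; have Kdiv := invariant_trace_field_div.
have [Kaa Kbb Kab] := invariant_trace_field_gens.
have [s [d [ss s_irr KE]]] := rat_degree2 quad.
have Kconj x : invariant_trace_field Gamma x -> exists y, quad_conj s x y.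
  by move=> /KE[p [q ->]]; exists (ratr p - ratr q * s), p, q.
pose c f := if f then b else a.
pose C f x y := cusps Gamma (hpoint (if f then x else - x) y).
have hpointN (x y : R) : hpoint (- x) (- y) = hpoint x y.
  by rewrite -[- x]mulN1r -[- y]mulN1r hpoint_scale // oppr_eq0 oner_eq0.
have cusp_eq g (x y x' y' : R) : G g -> cusps Gamma (hpoint x y) ->
    x' = g 0 0 * x + g 0 1 * y -> y' = g 1 0 * x + g 1 1 * y ->
    cusps Gamma (hpoint x' y').
  by move=> Gg xy -> ->; exact: cusp_mulmx.
have hyp1 f w1 w2 : C f w2 (c f * w2 - w1) -> C f w1 w2.
  case: f; rewrite /C /c => h.
    by apply: (cusp_eq _ _ _ _ _ GY.1 h); rewrite YE !mx2E; ring.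
  by rewrite -hpointN opprK; apply: (cusp_eq _ _ _ _ _ GX.1 h); rewrite XE !mx2E; ring.
have hyp2 f w1 w2 : C f w2 w1 -> C f w1 w2.
  case: f; rewrite /C => h.
    by apply: (cusp_eq _ _ _ _ _ G3 h); rewrite !mx2E; ring.
  rewrite -hpointN opprK.
  by apply: (cusp_eq _ _ _ _ _ G3 h); rewrite !mx2E; ring.
have hyp3 f w1 w2 : C (~~ f) w1 (- w2) -> C f w1 w2.
  by case: f; rewrite /C /= ?hpointN // -hpointN opprK.
have hyp4 f w : 0 < w -> C f w 0.
  by move=> _; rewrite /C /hpoint eqxx; exact: cusp_infty.
have hyp5 f w : c f = 2 -> 0 < w -> C f w w.
  case: f; rewrite /C /c => c2 w_gt0; rewrite /hpoint gt_eqF // ?mulNr divff ?gt_eqF //.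
    exact: cusp_vertex_b.
  exact: cusp_vertex_a.
(* Were a^2, b^2 and a b rational, the grading argument with K = Q would make the whole invariant
   trace field rational. *)
have c_irr : ~ exists p q r : rat,
    [/\ c true ^+ 2 = ratr p, c false ^+ 2 = ratr q & c true * c false = ratr r].
  move=> [p [q [r [/= ep eq er]]]].
  pose Q : set R := [set x | exists p : rat, x = ratr p].
  have Qdiv : GRing.divring_closed [in Q].
    apply/divring_closedP; split=> [|_ _ [u ->] [v ->]|_ _ [u ->] [v ->]].
    - by exists 1; rewrite rmorph1.
    - by exists (u - v); rewrite rmorphB.
    - by exists (u / v); rewrite fmorph_div.
  have KQ : invariant_trace_field Gamma `<=` Q.
    apply: invariant_trace_field_sub => //; first by exists p.
    by exists r; rewrite mulrC.
  have /KQ[u su] : invariant_trace_field Gamma s.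
    by apply/KE; exists 0, 1; rewrite rmorph0 rmorph1 add0r mul1r.
  exact: s_irr su.
have c_param f : tri_param (c f) by case: f.
have c_sqr f : exists y, quad_conj s (c f ^+ 2) y by case: f; exact: Kconj.
have c_mul : exists y, quad_conj s (c true * c false) y.
  by rewrite mulrC; exact: Kconj.
have main := @quadratic_descent R s d ss s_irr c c_param b_gt0 c_sqr c_mul c_irr C
  hyp1 hyp2 hyp3 hyp4 hyp5.
have [z_lt0|z_gt0|->] := ltgtP z 0.
- have [||k k_gt0] := main false (- z); first by rewrite oppr_gt0.
    by apply: Kconj; rewrite mulNr; exact: (divringN Kdiv).
  by rewrite /C /hpoint gt_eqF // mulrN opprK mulrAC divff ?mul1r // gt_eqF.
- have [//||k k_gt0] := main true z; first exact: Kconj.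
  by rewrite /C /hpoint gt_eqF // mulrAC divff ?mul1r // gt_eqF.
have -> : Some (0 : R) = hpoint 0 1 by rewrite /hpoint oner_eq0 mul0r.
have inf : cusps Gamma (hpoint 1 0) by rewrite /hpoint eqxx; exact: cusp_infty.
by apply: (cusp_eq _ _ _ _ _ G3 inf); rewrite !mx2E; ring.
Qed.

(** The cusps are b K and infinity, so up to scaling they form the projective line over K, whose
    cross-ratios are exactly its own points. *)
Lemma CR_tri_group : CR (cusps Gamma) = P1_over (invariant_trace_field Gamma).
Proof.
set K := invariant_trace_field Gamma.
have Kdiv : GRing.divring_closed [in K] := invariant_trace_field_div.
have [Kaa Kbb Kab] := invariant_trace_field_gens.
have b0 : b != 0 by rewrite gt_eqF.
have cuspE z : cusps Gamma (Some z) <-> oddK b K z.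
  by split; [exact: cusps_odd|exact: odd_cusps].
apply/seteqP; split=> c.
  move=> [p1 [p2 [p3 [p4 [[X1 X2] [X3 X4] _ ->]]]]].
  (* Multiplication by b takes b K into K, because [b ^+ 2] is in K. *)
  pose B : 'M[R]_2 := mx2 b 0 0 1.
  have dB : \det B != 0 by rewrite det_mx2E !mx2E mulr1 mul0r subr0.
  rewrite -(cross_ratio_mobius _ _ _ _ dB).
  have KB p : cusps Gamma p -> P1_over K (mobius B p).
    case: p => [z /cuspE Kz|_]; rewrite /= /hpoint !mx2E ?eqxx //.
    by rewrite mul0r add0r oner_eq0 addr0 divr1 mulrC.
  have Kdet p q : P1_over K p -> P1_over K q -> K (hdet p q).
    case: p => [x|] Kx; case: q => [y|] Ky /=; try exact: (divring1 Kdiv); try exact: (divring0 Kdiv).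
      exact: (divringB Kdiv).
    by apply: (divringN Kdiv) => //; exact: (divring1 Kdiv).
  rewrite /cross_ratio /hpoint; case: ifP => //= _.
  by apply: (divring_div Kdiv) => //; apply: (divringM Kdiv) => //; apply: Kdet; exact: (KB).
have cb x : K x -> cusps Gamma (Some (x * b)).
  by move=> Kx; apply/cuspE; rewrite /oddK -mulrA -expr2; exact: (divringM Kdiv).
have c0 : cusps Gamma (Some 0) by have := cb _ (divring0 Kdiv); rewrite mul0r.
have c1 : cusps Gamma (Some b) by have := cb _ (divring1 Kdiv); rewrite mul1r.
case: c => [x Kx|_]; last first.
  (* Equal first and fourth points make the denominator vanish. *)
  exists None, (Some 0), (Some b), None; split=> //.
  - by split=> //; exact: cusp_infty.
  - by split=> //; exact: cusp_infty.
  - by rewrite /= !inE /= !(inj_eq Some_inj) eq_sym (negPf b0).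
  - by rewrite /cross_ratio /hpoint /= mul0r eqxx.
(* The cross-ratio is (x b) / b = x. For x = 0 or 1 two points coincide, but three distinct ones
   remain. *)
exists (Some b), (Some (x * b)), None, (Some 0); split.
- by split=> //; exact: cb.
- by split=> //; exact: cusp_infty.
- rewrite /= !inE /= !(inj_eq Some_inj) (negPf b0).
  have [->|x0] := eqVneq (x * b) 0; first by rewrite (negPf b0).
  by case: ifP.
- rewrite /cross_ratio /hpoint /= !subr0 mulf_eq0 (negPf b0) oppr_eq0 oner_eq0 /=.
  by congr Some; field.
Qed.

End NormalFormCusps.

(** * Reflections and triangles *)

Section ComplexCoordinates.
Variable R : realType.
Implicit Types x y u v : R.

Lemma rcE x : real_complex R x = Complex x 0.
Proof. by []. Qed.

Lemma mulCE x y u v :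
  Complex x y * Complex u v = Complex (x * u - y * v) (x * v + y * u) :> R[i].
Proof. by []. Qed.

Lemma addCE x y u v : Complex x y + Complex u v = Complex (x + u) (y + v) :> R[i].
Proof. by []. Qed.

Lemma oppCE x y : - Complex x y = Complex (- x) (- y) :> R[i].
Proof. by []. Qed.

Lemma invCE x y : (Complex x y)^-1 =
  Complex (x / (x ^+ 2 + y ^+ 2)) (- (y / (x ^+ 2 + y ^+ 2))) :> R[i].
Proof. by []. Qed.

Lemma eqC0 x y : (Complex x y == 0 :> R[i]) = (x == 0) && (y == 0).
Proof. exact: eq_complex. Qed.

Definition complexE := (mulCE, addCE, oppCE).

Lemma hpoint_Some (F : fieldType) (n d z : F) :
  hpoint n d = Some z <-> d != 0 /\ n = z * d.
Proof.
rewrite /hpoint; case: (eqVneq d 0) => [_|d0]; split=> //.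
- by case.
- by move=> [<-]; rewrite divfK.
- by move=> [_ ->]; rewrite mulfK.
Qed.

Lemma normalized_Re (t : R[i]) (k u v : R) : 0 < k -> u ^+ 2 + v ^+ 2 = 1 ->
  t = Complex (k * u) (k * v) -> complex.Re (t / `|t|) = u.
Proof.
move=> k_gt0 uv ->; rewrite normc_def /=.
have -> : (k * u) ^+ 2 + (k * v) ^+ 2 = k ^+ 2.
  by rewrite -[RHS]mulr1 -uv; ring.
by rewrite sqrtr_sqr gtr0_norm // expr0n addr0; field; rewrite gt_eqF.
Qed.

Lemma normalized_Re_inv (t : R[i]) (k u v : R) : 0 < k -> u ^+ 2 + v ^+ 2 = 1 ->
  t = Complex (k * u) (k * v) -> complex.Re (t^-1 / `|t^-1|) = u.
Proof.
move=> k_gt0 uv ->; apply: (@normalized_Re _ k^-1 u (- v)).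
- by rewrite invr_gt0.
- by rewrite sqrrN.
rewrite invCE.
have -> : (k * u) ^+ 2 + (k * v) ^+ 2 = k ^+ 2.
  by rewrite -[RHS]mulr1 -uv; ring.
by congr Complex; field; rewrite gt_eqF.
Qed.

Lemma normalized_Re1 (t : R[i]) : complex.Re (t / `|t|) = 1 ->
  exists2 k : R, 0 < k & t = Complex k 0.
Proof.
case: t => x y; rewrite normc_def /=; set k := Num.sqrt _.
rewrite expr0n addr0 mul0r oppr0 mulr0 subr0.
have k_ge0 : 0 <= k by rewrite sqrtr_ge0.
have [->|k0] := eqVneq k 0; first by rewrite mul0r mulr0 => /eqP; rewrite eq_sym oner_eq0.
have {}k_ge0 : 0 < k by rewrite lt0r k0.
have -> : x * (k / k ^+ 2) = x / k by field.
move=> /(congr1 ( *%R^~ k)); rewrite divfK // mul1r => xk.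
have k2 : k ^+ 2 = x ^+ 2 + y ^+ 2 by rewrite sqr_sqrtr // addr_ge0 // sqr_ge0.
exists k => //; congr Complex => //.
by apply/eqP; rewrite -sqrf_eq0 -(addKr (x ^+ 2) (y ^+ 2)) -k2 xk addNr.
Qed.

Lemma normalized_Re_bound (t : R[i]) : -1 <= complex.Re (t / `|t|) <= 1.
Proof.
have [->|t0] := eqVneq t 0; first by rewrite mul0r /= lerN10 ler01.
have : `|t / `|t| | = 1 by rewrite normrM normfV normr_id divff // normr_eq0.
move: (t / `|t|) => w; rewrite normc_def => -[/(congr1 (fun x : R => x ^+ 2))].
rewrite /= expr1n sqr_sqrtr ?addr_ge0 ?sqr_ge0 // => e.
rewrite -ler_norml -(@expr_le1 _ 2) ?normr_ge0 // real_normK ?num_real //.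
by rewrite -e lerDl sqr_ge0.
Qed.

End ComplexCoordinates.

Section Reflections.
Variable R : realType.
Implicit Types (g h : 'M[R]_2) (x y : R).

(** The trace vanishes, since (tr g)^2 = tr (g^2) + 2 det g = 2 - 2. *)
Lemma reflection_entries g : reflection g ->
  g 1 1 = - g 0 0 /\ g 0 0 ^+ 2 + g 0 1 * g 1 0 = 1.
Proof.
move=> [dg gg].
have e00 : g 0 0 * g 0 0 + g 0 1 * g 1 0 = 1 by rewrite -mulmx2E gg mx2_1E.
have e11 : g 1 0 * g 0 1 + g 1 1 * g 1 1 = 1 by rewrite -mulmx2E gg mx2_1E.
move: dg; rewrite det_mx2E => dg; split; last by rewrite expr2.
have : (g 0 0 + g 1 1) ^+ 2 = 0.
  transitivity ((g 0 0 * g 0 0 + g 0 1 * g 1 0) + (g 1 0 * g 0 1 + g 1 1 * g 1 1) +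
    2 * (g 0 0 * g 1 1 - g 0 1 * g 1 0)); first by ring.
  by rewrite e00 e11 dg; ring.
by move=> /eqP; rewrite sqrf_eq0 addrC addr_eq0 => /eqP.
Qed.

Lemma mirror_SomeE g x y : reflection g -> on_mirror g (Some (Complex x y)) <->
  g 1 0 * (x ^+ 2 + y ^+ 2) - 2 * g 0 0 * x - g 0 1 = 0.
Proof.
move=> /reflection_entries[e11 det].
rewrite /on_mirror /anti_mobius /= !mxE hpoint_Some.
rewrite !rcE !complexE e11.
split=> [[_ [e _]]|e].
  by move: e; lra.
split; last by congr Complex; lra.
(* If the denominator vanished, the mirror equation would give g00^2 + g01 g10 = (g10 y)^2 = 0,
   whereas this is - det g = 1. *)
rewrite eqC0; apply/negP => /andP[/eqP e1 /eqP e2].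
have : g 0 0 ^+ 2 + g 0 1 * g 1 0 = 0.
  have g00 : g 0 0 = g 1 0 * x by lra.
  have g01 : g 0 1 = g 1 0 * (x ^+ 2 + y ^+ 2) - 2 * g 0 0 * x by lra.
  have gy : g 1 0 * y = 0 by lra.
  rewrite g01 g00; transitivity ((g 1 0 * y) ^+ 2); first by ring.
  by rewrite gy expr0n.
by rewrite det => /eqP; rewrite oner_eq0.
Qed.

Lemma mirror_NoneE g : on_mirror g None <-> g 1 0 = 0.
Proof.
rewrite /on_mirror /anti_mobius /= !mxE /hpoint rcE.
rewrite eqC0 eqxx andbT; split=> [|->]; last by rewrite eqxx.
by case: eqVneq.
Qed.

Local Notation toC h := (map_mx (real_complex R) h).

Lemma det_toC h : \det h != 0 -> \det (toC h) != 0.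
Proof. by rewrite det_map_mx fmorph_eq0. Qed.

Lemma omap_conj_mobius h p :
  omap (@conjc R) (mobius (toC h) p) = mobius (toC h) (omap (@conjc R) p).
Proof.
have H n d : omap (@conjc R) (hpoint n d) = hpoint (conjc n) (conjc d).
  by rewrite /hpoint conjc_eq0; case: ifP => //= _; rewrite rmorphM /= conjc_inv.
by case: p => [z|] /=; rewrite H !mxE ?rmorphD ?rmorphM /= ?oppr0.
Qed.

Lemma mirror_conjm g h p : \det h != 0 -> \det g != 0 ->
  on_mirror (conjm h g) (mobius (toC h) p) <-> on_mirror g p.
Proof.
move=> dh dg; have dhC := det_toC dh.
have : anti_mobius (conjm h g) (mobius (toC h) p) = mobius (toC h) (anti_mobius g p).
  have e : toC (conjm h g) *m toC h = toC h *m toC g.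
    by rewrite -!map_mxM -[_ *m _]/(conjm h g * h) /conjm divrK // unitmx2E.
  rewrite /anti_mobius omap_conj_mobius -(mobiusM _ _ dhC).
  by rewrite -[toC _ * _]/(toC _ *m _) e -[_ *m _]/(toC h * toC g) (mobiusM _ _ (det_toC dg)).
rewrite /on_mirror => ->; split=> [|-> //].
exact: (can_inj (mobiusK dhC)).
Qed.

Lemma reflection_conjm g h : \det h != 0 -> reflection g -> reflection (conjm h g).
Proof.
by move=> dh [dg gg]; split; [rewrite det_conjm|rewrite -conjmM // gg conjm1].
Qed.

End Reflections.

(** * Moving a finite ideal vertex to infinity *)

Section Inversion.
Variables (R : realType) (x0 : R).

(** The map z |-> -1 / (z - x0), an orientation-preserving isometry sending x0 to infinity. *)
Definition inversion : 'M[R]_2 := mx2 0 (-1) 1 (- x0).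
Local Notation hC := (map_mx (real_complex R) inversion).
Local Notation r0 := (Complex x0 0).

Lemma det_inversion : \det inversion = 1.
Proof. by rewrite det_mx2E !mx2E; ring. Qed.

Lemma inversion_Some z : mobius hC (Some z) = hpoint (- 1) (z - r0).
Proof.
rewrite /= [_ 0 0]mxE [_ 0 1]mxE [_ 1 0]mxE [_ 1 1]mxE !mx2E.
by rewrite !rmorphN rmorph0 rmorph1 mul0r mul1r add0r.
Qed.

Lemma inversion_None : mobius hC None = Some 0.
Proof.
rewrite /= [_ 0 0]mxE [_ 1 0]mxE !mx2E rmorph0 rmorph1.
by rewrite /hpoint oner_eq0 mul0r.
Qed.

Lemma inversion_in_closed_plane p : in_closed_plane p -> in_closed_plane (mobius hC p).
Proof.
case: p => [[x y] y_ge0|_]; last by rewrite inversion_None /= lexx.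
rewrite inversion_Some /hpoint; case: ifP => // _.
rewrite /= !oppr0 mul0r !addr0 mulrN mulN1r opprK.
by rewrite divr_ge0 // addr_ge0 ?sqr_ge0.
Qed.

(** Two disc charts centred at corresponding points differ by a rotation, here V' / V. It cancels in
    the quotient that defines an angle. *)
Lemma inversion_cayley (v : R[i]) : complex.Im v != 0 ->
  exists2 k : R[i], k != 0 &
    forall p, cayley (-1 / (v - r0)) (mobius hC p) = k * cayley v p.
Proof.
case: v => x y /= y0; set v := Complex x y.
pose V := v - r0; pose V' := conjc v - r0.
have V0 : V != 0 by rewrite /V /v !complexE eqC0 negb_and subr0 y0 orbT.
have V'0 : V' != 0 by rewrite /V' /v !complexE eqC0 negb_and subr0 oppr_eq0 y0 orbT.
have conjV : conjc (-1 / V) = -1 / V'.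
  have cV : conjc V = V' by rewrite /V /V' rmorphB /= oppr0.
  by rewrite rmorphM rmorphN rmorph1 fmorphV -cV.
exists (V' / V); first by rewrite mulf_neq0 // invr_eq0.
case=> [w|]; last first.
  rewrite inversion_None /cayley conjV -/V.
  by field; rewrite V0 V'0.
rewrite inversion_Some /hpoint subr_eq0; case: eqVneq => [->|w0].
  rewrite /cayley -(opprB v) -/V -(opprB (conjc v)) -/V'.
  by field; rewrite V0 V'0.
rewrite /cayley conjV -/V.
have -> : w - v = (w - r0) - V by rewrite /V; ring.
have -> : w - conjc v = (w - r0) - V' by rewrite /V'; ring.
have {}w0 : w - r0 != 0 by rewrite subr_eq0.
move: (w - r0) w0 => W W0.
have -> : -1 / W - -1 / V = (W - V) / (W * V) by field; rewrite W0 V0.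
have -> : -1 / W - -1 / V' = (W - V') / (W * V') by field; rewrite W0 V'0.
(* The point p is arbitrary, so W - V' may be 0. Its inverse is abstracted, and the identity holds
   with the default value too. *)
by rewrite !invfM !invrK; move: (W - V')^-1 => I; field; rewrite W0 V0.
Qed.

Lemma inversion_vertex_angle v p q :
  vertex_angle (mobius hC v) (mobius hC p) (mobius hC q) = vertex_angle v p q.
Proof.
case: v => [v|]; last first.
  by rewrite inversion_None /= eqxx.
have [v0|v0] := eqVneq (complex.Im v) 0.
  rewrite {2}/vertex_angle v0 eqxx inversion_Some /hpoint.
  case: ifP => // _; rewrite /vertex_angle.
  case: v v0 => x y /= ->.
  by rewrite /= !oppr0 addr0 !mul0r oppr0 mulr0 addr0 eqxx.
have [k k0 kE] := inversion_cayley v0.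
rewrite inversion_Some /hpoint.
case: v v0 kE => x y /= y0 kE; set v := Complex x y.
have V0 : v - r0 != 0 by rewrite /v !complexE eqC0 negb_and subr0 y0 orbT.
rewrite (negPf V0) /vertex_angle.
have -> : complex.Im (-1 / (v - r0)) == 0 = false.
  apply/negbTE; rewrite /= !oppr0 mul0r !addr0 mulrN mulN1r opprK.
  rewrite mulf_neq0 // invr_eq0.
  by rewrite gt_eqF // ltr_wpDl ?sqr_ge0 // exprn_even_gt0.
by rewrite /= (negPf y0) !kE -mulf_div divff // mul1r.
Qed.

End Inversion.

Section Triangle.
Variable R : realType.
Implicit Types (g h : 'M[R]_2) (x y : R).

Lemma cayleyE x y x' y' : (x' - x) ^+ 2 + (y' + y) ^+ 2 != 0 ->
  cayley (Complex x y) (Some (Complex x' y')) =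
  Complex (((x' - x) ^+ 2 + y' ^+ 2 - y ^+ 2) / ((x' - x) ^+ 2 + (y' + y) ^+ 2))
          (2 * y * (x - x') / ((x' - x) ^+ 2 + (y' + y) ^+ 2)).
Proof.
move=> S0; rewrite /cayley /=.
have -> : Complex x' y' - Complex x (- y) = Complex (x' - x) (y' + y).
  by rewrite !complexE opprK.
have -> : Complex x' y' - Complex x y = Complex (x' - x) (y' - y) by [].
by rewrite invCE mulCE; congr Complex; field.
Qed.

Lemma sqr_add_gt0 x y : 0 < y -> 0 < x ^+ 2 + y ^+ 2.
Proof. by move=> y_gt0; rewrite ltr_wpDl ?sqr_ge0 // exprn_gt0. Qed.

(* In the disc model centred at a point of the mirror, the mirror is a diameter. *)
Lemma mirror_cayley g x y p : reflection g -> 0 < y ->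
  on_mirror g (Some (Complex x y)) -> in_closed_plane p ->
  let u := cayley (Complex x y) p in
  on_mirror g p <->
  g 1 0 * y * complex.Re u - (g 1 0 * x - g 0 0) * complex.Im u = 0.
Proof.
move=> rg y_gt0 /mirror_SomeE-/(_ rg) gz.
case: p => [[x' y'] y'_ge0|_] u; last first.
  rewrite mirror_NoneE /u /= mulr1 mulr0 subr0; split=> [->|/eqP].
    by rewrite mul0r.
  by rewrite mulf_eq0 (gt_eqF y_gt0) orbF => /eqP.
rewrite /= in y'_ge0.
have S_gt0 : 0 < (x' - x) ^+ 2 + (y' + y) ^+ 2 by rewrite sqr_add_gt0 // ltr_wpDl.
rewrite mirror_SomeE // /u cayleyE ?gt_eqF //=.
set S := _ + _ in S_gt0 *.
have -> : g 1 0 * y * (((x' - x) ^+ 2 + y' ^+ 2 - y ^+ 2) / S) -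
    (g 1 0 * x - g 0 0) * (2 * y * (x - x') / S) =
  y / S * ((g 1 0 * (x' ^+ 2 + y' ^+ 2) - 2 * g 0 0 * x' - g 0 1) -
           (g 1 0 * (x ^+ 2 + y ^+ 2) - 2 * g 0 0 * x - g 0 1)).
  by field; rewrite gt_eqF.
rewrite gz subr0; split=> [->|/eqP]; first by rewrite mulr0.
by rewrite !mulf_eq0 invr_eq0 (gt_eqF y_gt0) (gt_eqF S_gt0) => /eqP.
Qed.

Lemma acos_eq0 x : -1 <= x <= 1 -> acos x = 0 -> x = 1.
Proof. by move=> x1 e; rewrite -[LHS]acosK ?in_itv //= e cos0. Qed.

(** At an interior vertex, angle 0 would put v1 and v2 on one ray, hence v1 on the mirror through v2
    and v3. *)
Lemma zero_angle_ideal g v1 v2 v3 : reflection g ->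
  in_closed_plane v1 -> in_closed_plane v2 -> in_closed_plane v3 ->
  on_mirror g v2 -> on_mirror g v3 -> ~ on_mirror g v1 ->
  vertex_angle v3 v1 v2 = 0 -> ideal v3.
Proof.
move=> rg P1 P2 P3 g2 g3 ng1; case: v3 P3 g3 => // -[x y] /= y_ge0 g3.
case: eqVneq => // y0 /acos_eq0-/(_ (normalized_Re_bound _))/normalized_Re1[k k_gt0 e].
have y_gt0 : 0 < y by rewrite lt0r y0.
case: ng1; apply/(mirror_cayley rg y_gt0 g3 P1).
have /(mirror_cayley rg y_gt0 g3 P2) := g2.
set u := cayley (Complex x y) v2 in e *; set w := cayley (Complex x y) v1 in e *.
have u0 : u != 0.
  apply/eqP => u0; move: e; rewrite u0 invr0 mulr0 => -[] k0.
  by rewrite -k0 ltxx in k_gt0.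
have -> : w = Complex k 0 * u by rewrite -e divfK.
case: (u) => p q /=; rewrite !mul0r subr0 addr0 => e'.
by transitivity (k * (g 1 0 * y * p - (g 1 0 * x - g 0 0) * q)); [ring|rewrite e' mulr0].
Qed.

(** In this chart infinity is 1, so u is the cosine of the angle between the vertical ray and the
    arc towards (x', y'). Eliminating y^2 and y'^2 by the circle equations leaves the numerator 2 (x
    - x')(x - c0). *)
Lemma circle_cayley c0 r x y x' y' : 0 < r -> 0 < y -> 0 <= y' -> x != x' ->
  (x - c0) ^+ 2 + y ^+ 2 = r ^+ 2 -> (x' - c0) ^+ 2 + y' ^+ 2 = r ^+ 2 ->
  let s := Num.sg (x - x') in
  exists k u v, [/\ 0 < k, u ^+ 2 + v ^+ 2 = 1, u = s * (x - c0) / r &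
    cayley (Complex x y) (Some (Complex x' y')) = Complex (k * u) (k * v)].
Proof.
move=> r_gt0 y_gt0 y'_ge0 xx' e e' s.
have S_gt0 : 0 < (x' - x) ^+ 2 + (y' + y) ^+ 2 by rewrite sqr_add_gt0 // ltr_wpDl.
have d0 : x - x' != 0 by rewrite subr_eq0.
have ss : s ^+ 2 = 1 by rewrite sqr_sg d0.
have ds : x - x' = s * `|x - x'| by rewrite -numEsg.
rewrite cayleyE ?gt_eqF //; set S := _ + _ in S_gt0 *.
exists (2 * r * `|x - x'| / S), (s * (x - c0) / r), (s * y / r); split=> //.
- by rewrite !mulr_gt0 ?invr_gt0 // ?normr_gt0.
- transitivity (s ^+ 2 * ((x - c0) ^+ 2 + y ^+ 2) / r ^+ 2).
    by field; rewrite gt_eqF.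
  by rewrite ss e mul1r divff // expf_neq0 // gt_eqF.
have y2 : y ^+ 2 = r ^+ 2 - (x - c0) ^+ 2 by rewrite -e addrAC subrr add0r.
have y'2 : y' ^+ 2 = r ^+ 2 - (x' - c0) ^+ 2 by rewrite -e' addrAC subrr add0r.
congr Complex.
  transitivity (2 * (x - x') * (x - c0) / S).
    by rewrite y2 y'2; congr (_ / _); ring.
  by rewrite {1}ds; field; rewrite !gt_eqF.
by rewrite {1}ds; field; rewrite !gt_eqF.
Qed.

Lemma vertex_angleE (z : R[i]) p q : complex.Im z != 0 ->
  vertex_angle (Some z) p q =
  acos (complex.Re (cayley z p / cayley z q / `|cayley z p / cayley z q|)).
Proof. by rewrite /vertex_angle => /negPf ->. Qed.

Lemma circle_angle c0 r x y x' y' (t : R) : 0 < r -> 0 <= y -> 0 <= y' -> x != x' ->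
  (x - c0) ^+ 2 + y ^+ 2 = r ^+ 2 -> (x' - c0) ^+ 2 + y' ^+ 2 = r ^+ 2 ->
  vertex_angle (Some (Complex x y)) (Some (Complex x' y')) None = t \/
  vertex_angle (Some (Complex x y)) None (Some (Complex x' y')) = t ->
  x - c0 = Num.sg (x - x') * r * cos t.
Proof.
move=> r_gt0 y_ge0 y'_ge0 xx' e e'.
set s := Num.sg _.
have ss : s * s = 1 by rewrite -expr2 sqr_sg subr_eq0 xx'.
(* At an ideal vertex the angle is 0 by convention, and x is an end of the half-circle; the position
   of x' tells which one. *)
have [y0|y0] := eqVneq y 0.
  rewrite /vertex_angle /= y0 eqxx => t0.
  have -> : t = 0 by case: t0.
  rewrite cos0 mulr1.
  have : (x - c0 == r) || (x - c0 == - r) by rewrite -eqf_sqr -e y0 expr0n addr0.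
  have le_x' : `|x' - c0| <= r.
    rewrite -(@ler_pXn2r _ 2) ?nnegrE ?normr_ge0 ?(ltW r_gt0) // real_normK ?num_real // -e' lerDl.
    exact: sqr_ge0.
  move: le_x'; rewrite ler_norml => /andP[h1 h2].
  rewrite /s; case: (ltgtP x x') xx' => // lt_x _ /orP[]/eqP ex.
  - by exfalso; lra.
  - by rewrite ltr0_sg ?subr_lt0 // mulN1r.
  - by rewrite gtr0_sg ?subr_gt0 // mul1r.
  - by exfalso; lra.
have y_gt0 : 0 < y by rewrite lt0r y0.
have [k [u [v [k_gt0 uv uE cE]]]] := circle_cayley r_gt0 y_gt0 y'_ge0 xx' e e'.
have u1 : -1 <= u <= 1.
  rewrite -ler_norml -(@expr_le1 _ 2) ?normr_ge0 // real_normK ?num_real //.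
  by rewrite -uv lerDl sqr_ge0.
have H : acos u = t -> x - c0 = s * r * cos t.
  move=> <-; rewrite acosK ?in_itv //= uE -/s.
  transitivity ((s * s) * (x - c0)); first by rewrite ss mul1r.
  by field; rewrite gt_eqF.
have cN : cayley (Complex x y) None = 1 by [].
rewrite !vertex_angleE // cN divr1 div1r (normalized_Re k_gt0 uv cE) (normalized_Re_inv k_gt0 uv cE).
by case; exact: H.
Qed.

Lemma scalemx2E (t : R) g i j : (t *: g) i j = t * g i j.
Proof. by rewrite mxE. Qed.

Lemma triangle_normal_form g1 g2 g3 v1 v2 (al be : R) :
  [/\ reflection g1, reflection g2 & reflection g3] ->
  in_closed_plane v1 -> in_closed_plane v2 ->
  [/\ on_mirror g1 v2 /\ on_mirror g1 None, on_mirror g2 None /\ on_mirror g2 v1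
    & on_mirror g3 v1 /\ on_mirror g3 v2] ->
  ~ on_mirror g1 v1 -> ~ on_mirror g3 None ->
  vertex_angle v1 v2 None = al -> vertex_angle v2 None v1 = be ->
  exists h, \det h != 0 /\ exists s1 s2 s3 : R,
    [/\ s1 ^+ 2 = 1 /\ conjm h g1 = s1 *: mx2 (-1) (2 * cos be) 0 1,
        s2 ^+ 2 = 1 /\ conjm h g2 = s2 *: mx2 (-1) (- (2 * cos al)) 0 1
      & s3 ^+ 2 = 1 /\ conjm h g3 = s3 *: mx2 0 1 1 0].
Proof.
move=> [r1 r2 r3] P1 P2 [[g12 /mirror_NoneE g1N] [/mirror_NoneE g2N g21] [g31 g32]].
move=> ng11 /mirror_NoneE/eqP g30.
case: v1 P1 g21 g31 ng11 => [[x1 y1] /= y1_ge0|_ _ /mirror_NoneE/eqP]; last by rewrite (negPf g30).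
case: v2 P2 g12 g32 => [[x2 y2] /= y2_ge0|_ _ /mirror_NoneE/eqP]; last by rewrite (negPf g30).
have [e11 d1] := reflection_entries r1; have [e21 d2] := reflection_entries r2.
have [e31 d3] := reflection_entries r3.
move=> /(mirror_SomeE _ _ r1) g12 /(mirror_SomeE _ _ r3) g32.
move=> /(mirror_SomeE _ _ r2) g21 /(mirror_SomeE _ _ r3) g31 ng11 hal hbe.
rewrite g1N mulr0 addr0 in d1; rewrite g2N mulr0 addr0 in d2.
rewrite g1N mul0r add0r in g12; rewrite g2N mul0r add0r in g21.
have x12 : x1 != x2.
  apply/eqP => e; apply: ng11; apply/mirror_SomeE => //.
  by rewrite g1N mul0r add0r e.
pose c0 := g3 0 0 / g3 1 0; pose r := `|g3 1 0|^-1.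
have r_gt0 : 0 < r by rewrite invr_gt0 normr_gt0.
have r2E : r ^+ 2 = (g3 1 0 ^+ 2)^-1 by rewrite exprVn real_normK ?num_real.
have circle x y : g3 1 0 * (x ^+ 2 + y ^+ 2) - 2 * g3 0 0 * x - g3 0 1 = 0 ->
    (x - c0) ^+ 2 + y ^+ 2 = r ^+ 2.
  move=> e; transitivity ((g3 1 0 * (x ^+ 2 + y ^+ 2) - 2 * g3 0 0 * x - g3 0 1) / g3 1 0
    + (g3 0 0 ^+ 2 + g3 0 1 * g3 1 0) / g3 1 0 ^+ 2).
    by rewrite /c0; field.
  by rewrite e d3 r2E mul0r add0r div1r.
have c1 := circle _ _ g31; have c2 := circle _ _ g32.
have a1 := circle_angle r_gt0 y1_ge0 y2_ge0 x12 c1 c2 (or_introl hal).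
rewrite eq_sym in x12.
have a2 := circle_angle r_gt0 y2_ge0 y1_ge0 x12 c2 c1 (or_intror hbe).
set s := Num.sg (x2 - x1) in a2.
have ss : s ^+ 2 = 1 by rewrite sqr_sg subr_eq0 x12.
rewrite -(opprB x2 x1) sgrN -/s in a1.
have s0 : s != 0 by rewrite -sqrf_eq0 ss oner_eq0.
(* The map z |-> s (z - c0) / r takes the circle to the unit circle and x1, x2 to - cos al, cos be.
   Its determinant is negative if s = -1, which conjugation of matrices allows. *)
pose h : 'M[R]_2 := mx2 (s / r) (- s * c0 / r) 0 1.
have dh : \det h != 0.
  by rewrite det_mx2E !mx2E mulr0 subr0 mulr1 mulf_neq0 // invr_eq0 gt_eqF.
have uh : h \is a GRing.unit by rewrite unitmx2E.
have conjP g (t : R) (n : 'M[R]_2) : h * g = (t *: n) * h -> conjm h g = t *: n.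
  by rewrite /conjm => ->; rewrite mulrK.
have r0 : r != 0 by rewrite gt_eqF.
have x1E : x1 = c0 - s * r * cos al by rewrite -[LHS](subrK c0) a1; ring.
have x2E : x2 = c0 + s * r * cos be by rewrite -[LHS](subrK c0) a2; ring.
have q1 : g1 0 1 = - 2 * g1 0 0 * x2 by clear -g12; lra.
have q2 : g2 0 1 = - 2 * g2 0 0 * x1 by clear -g21; lra.
have q3 : g3 0 1 = g3 1 0 * (r ^+ 2 - c0 ^+ 2).
  rewrite r2E /c0; apply: (mulIf g30).
  transitivity (1 - g3 0 0 ^+ 2); first by rewrite -d3; ring.
  by field.
have p3 : g3 0 0 = g3 1 0 * c0 by rewrite /c0 mulrC divfK.
exists h; split=> //; exists (- g1 0 0), (- g2 0 0), (s * r * g3 1 0).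
split; split; rewrite ?sqrrN //.
- apply: conjP; apply: mx2_ext; rewrite !mulmx2E !scalemx2E !mx2E ?e11 ?g1N ?q1 ?x2E;
  try by ring.
  transitivity (- (2 * g1 0 0 * c0 * s / r) - (2 * g1 0 0 * s ^+ 2 * cos be) + s * c0 / r * g1 0 0).
    by field.
  by rewrite ss; field.
- apply: conjP; apply: mx2_ext; rewrite !mulmx2E !scalemx2E !mx2E ?e21 ?g2N ?q2 ?x1E;
  try by ring.
  transitivity (- (2 * g2 0 0 * c0 * s / r) + (2 * g2 0 0 * s ^+ 2 * cos al) + s * c0 / r * g2 0 0).
    by field.
  by rewrite ss; field.
- by rewrite !exprMn ss r2E mul1r mulVf // expf_neq0.
- apply: conjP; apply: mx2_ext; rewrite !mulmx2E !scalemx2E !mx2E ?e31 ?q3 ?p3.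
  + by field.
  + by field.
  + transitivity (s ^+ 2 * g3 1 0); first by rewrite ss; ring.
    by field.
  + transitivity (- (s ^+ 2 * g3 1 0 * c0)); first by rewrite ss; ring.
    by field.
Qed.

End Triangle.

Section Angles.
Variable R : realType.

Lemma cheb_cos (t : R) n : cheb (2 * cos t) n * sin t = sin (n%:R * t).
Proof.
have [m] := ubnP n; elim: m n => // m IHm [|[|n]] nm.
- by rewrite !mul0r sin0.
- by rewrite !mul1r.
have e2 : n.+2%:R * t = n.+1%:R * t + t by rewrite mulrSr mulrDl mul1r.
have e0 : n%:R * t = n.+1%:R * t - t by rewrite mulrSr mulrDl mul1r addrK.
have -> : cheb (2 * cos t) n.+2 * sin t = 2 * cos t *
    (cheb (2 * cos t) n.+1 * sin t) - cheb (2 * cos t) n * sin t.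
  by rewrite chebSS; ring.
by rewrite !IHm ?e2 ?e0 ?sinB ?sinD; [ring|lia|lia].
Qed.

Lemma tri_param_cos n : (1 < n)%N -> tri_param (2 * cos (pi / n%:R) : R).
Proof.
move=> n1; have n_gt0 : 0 < n%:R :> R by rewrite ltr0n; lia.
have pi_gt0 := pi_gt0 R.
have t_gt0 : 0 < pi / n%:R :> R by rewrite divr_gt0.
have sin_pos j : (0 < j < n)%N -> 0 < sin (j%:R * (pi / n%:R)) :> R.
  move=> /andP[j0 jn]; rewrite sin_gt0_pi // mulr_gt0 ?ltr0n //=.
  by rewrite mulrA ltr_pdivrMr // mulrC ltr_pM2l // ltr_nat.
have s_gt0 : 0 < sin (pi / n%:R) :> R by have := sin_pos 1%N; rewrite mul1r; apply; lia.
split.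
  rewrite mulr_ge0 // cos_ge0_pihalf // (le_trans _ (ltW t_gt0)) /=; last first.
    by rewrite oppr_le0 divr_ge0 // ltW.
  by rewrite ler_pM2l // lef_pV2 ?posrE // ler_nat.
left; exists n; split=> // [|j jn].
  apply: (mulIf (lt0r_neq0 s_gt0)).
  by rewrite cheb_cos mul0r mulrC divfK ?gt_eqF // sinpi.
by rewrite -(pmulr_lgt0 _ s_gt0) cheb_cos sin_pos.
Qed.

Lemma ereal_int_cases (n : \bar int) : (2%:E <= n)%E ->
  n = +oo%E \/ exists2 k : nat, (1 < k)%N & n = (Posz k)%:E.
Proof.
case: n => [[k|k]| |] //; last by left.
by rewrite lee_fin => k2; right; exists k.
Qed.

Lemma tri_param_recip (n : \bar int) : (2%:E <= n)%E ->
  tri_param (2 * cos (pi * recip R n)).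
Proof.
move=> /ereal_int_cases[->|[k k1 ->]]; last exact: tri_param_cos.
by rewrite /recip mulr0 cos0 mulr1; split=> //; right.
Qed.

(** The cosine vanishes only for m = 2, which forces l = 2 and the excluded sum 1/2 + 1/2. *)
Lemma recip_cos_gt0 (l m : \bar int) : (2%:E <= l)%E -> (l <= m)%E ->
  recip R l + recip R m < 1 -> 0 < cos (pi * recip R m).
Proof.
move=> l2 lm; have m2 := le_trans l2 lm.
case/ereal_int_cases: m2 lm => [->|[k k1 ->]] lm.
  by rewrite /= mulr0 cos0.
have [k3|k2] := ltnP 2 k => lm1.
  have pi_gt0 := pi_gt0 R.
  have k_gt0 : 0 < k%:R :> R by rewrite ltr0n; lia.
  have t_gt0 : 0 < pi / k%:R :> R by rewrite divr_gt0.
  rewrite /recip -[(k : int)%:~R]/(k%:R) cos_gt0_pihalf // (lt_trans _ t_gt0) /=; last first.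
    by rewrite oppr_lt0 divr_gt0.
  by rewrite ltr_pM2l // ltf_pV2 ?posrE // ltr_nat.
exfalso; have {k1 k2} k2 : k = 2%N by lia.
move: lm1; rewrite k2 in lm *.
case/ereal_int_cases: l2 lm => [->//|[j j1 ->]]; rewrite lee_fin => j2.
have -> : j = 2%N by lia.
by rewrite /= -[(2%Z)%:~R]/(2%:R : R); lra.
Qed.

End Angles.

Lemma signed_generators (R : realType) (X Y : set 'M[R]_2) :
  (forall x, X x -> exists2 y, Y y & x = y \/ x = - y) ->
  psubgroup_gen X `<=` psubgroup_gen Y.
Proof.
move=> XY; apply: psubgroup_subset => x /XY[y Yy [->|->]].
  exact: psubgroup_sub.
by apply: psubgroupN; exact: psubgroup_sub.
Qed.

Lemma sqr1_scale (R : realType) (s : R) (A B : 'M[R]_2) : s ^+ 2 = 1 -> A = s *: B ->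
  A = B \/ A = - B.
Proof.
move=> /eqP; rewrite sqrf_eq1 => /orP[]/eqP -> ->; first by left; rewrite scale1r.
by right; rewrite scaleN1r.
Qed.

(** Conjugation fixes the trace field and moves the cusps by a projective map, which preserves
    cross-ratios. The signs of the generators do not matter, as -1 belongs to every generated
    group. *)
Lemma CR_conjugate (R : realType) (a b : R) (g1 g2 g3 h : 'M[R]_2) (Gamma : set 'M[R]_2) :
  0 < b -> tri_param a -> tri_param b -> \det h != 0 ->
  [/\ reflection g1, reflection g2 & reflection g3] ->
  Gamma = [set g | psubgroup_gen [set g1; g2; g3] g /\ \det g = 1] ->
  (exists s1 s2 s3 : R,
    [/\ s1 ^+ 2 = 1 /\ conjm h g1 = s1 *: mx2 (-1) b 0 1,
        s2 ^+ 2 = 1 /\ conjm h g2 = s2 *: mx2 (-1) (- a) 0 1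
      & s3 ^+ 2 = 1 /\ conjm h g3 = s3 *: mx2 0 1 1 0]) ->
  rat_degree (invariant_trace_field Gamma) 2 ->
  CR (cusps Gamma) = P1_over (invariant_trace_field Gamma).
Proof.
move=> b_gt0 ap bp dh [r1 r2 r3] GE [s1 [s2 [s3 [[/sqr1_scale S1 /S1{}S1]
  [/sqr1_scale S2 /S2{}S2] [/sqr1_scale S3 /S3{}S3]]]]] quad.
have Gdet x : Gamma x -> \det x != 0 by rewrite GE => -[_ ->]; rewrite oner_eq0.
have Xdet x : [set g1; g2; g3] x -> \det x != 0.
  by move=> [[|]|] ->; [case: r1|case: r2|case: r3] => -> _; rewrite oppr_eq0 oner_eq0.
have dhV : \det h^-1 != 0 by rewrite det_inv2 invr_eq0.
have XE : psubgroup_gen [set conjm h x | x in [set g1; g2; g3]] = psubgroup_gen (tri_gens a b).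
  apply/seteqP; split; apply: signed_generators.
    move=> _ [x [[|]|] -> <-].
    - by exists (mx2 (-1) b 0 1); [left; left|].
    - by exists (mx2 (-1) (- a) 0 1); [left; right|].
    - by exists (mx2 0 1 1 0); [right|].
  have sym (A B : 'M[R]_2) : A = B \/ A = - B -> B = A \/ B = - A.
    by case=> ->; [left|right; rewrite opprK].
  move=> _ [[|]|] ->.
  - by exists (conjm h g1); [exists g1 => //; left; left|exact: sym].
  - by exists (conjm h g2); [exists g2 => //; left; right|exact: sym].
  - by exists (conjm h g3); [exists g3 => //; right|exact: sym].
have conjG : [set conjm h x | x in Gamma] = tri_group a b.
  rewrite GE; apply/seteqP; split=> [_ [x [Xx dx] <-]|x [Gx dx]].
    by split; [rewrite -XE; exact: psubgroup_conjm|rewrite det_conjm].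
  exists (conjm h^-1 x); last by rewrite conjmVK.
  split; last by rewrite det_conjm.
  have : psubgroup_gen [set conjm h^-1 x | x in [set conjm h x | x in [set g1; g2; g3]]] (conjm h^-1 x).
    apply: psubgroup_conjm => //; last by rewrite XE.
    by move=> _ [y Xy <-]; rewrite det_conjm // Xdet.
  apply: psubgroup_subset => _ [_ [y Xy <-] <-].
  by rewrite conjmK //; exact: psubgroup_sub.
have KE := invariant_trace_field_conjm dh Gdet; rewrite conjG in KE.
rewrite -KE in quad *; rewrite (cusps_conjm dh Gdet) conjG CR_mobius //.
by apply: CR_tri_group => //; case: ap.
Qed.

Lemma conjm_comp (R : realType) (h k g : 'M[R]_2) : \det h != 0 -> \det k != 0 ->
  conjm h (conjm k g) = conjm (h * k) g.
Proof.
by rewrite -!unitmx2E => uh uk; rewrite /conjm invrM // !mulrA.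
Qed.

Unset Implicit Arguments.

Theorem theorem5p4 (R : realType) (l m n : \bar int) (Gamma : set 'M[R]_2)
  (hGamma : is_triangle_group l m n Gamma)
  (noncocompact : n = +oo%E)
  (quadratic : rat_degree (invariant_trace_field Gamma) 2) :
  CR (cusps Gamma) = P1_over (invariant_trace_field Gamma).
Proof.
move: hGamma; rewrite noncocompact => -[l2 lm _ lmn [v1 [v2 [v3 [g1 [g2 [g3]]]]]]].
move=> [[P1 P2 P3 nondeg] [al1 al2 al3] refl [[g12 g13] [g23 g21] [g31 g32]] GE].
have [r1 r2 r3] := refl.
have ng11 : ~ on_mirror g1 v1 by move=> g11; apply: nondeg; exists g1.
have ng33 : ~ on_mirror g3 v3 by move=> g33; apply: nondeg; exists g3.
have v3_ideal : ideal v3.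
  by apply: (zero_angle_ideal r1 P1 P2 P3) => //; rewrite al3 /= mulr0.
have b_gt0 : 0 < 2 * cos (pi * recip R m).
  by rewrite mulr_gt0 // (recip_cos_gt0 l2) // -[ltLHS]addr0.
have a_param := tri_param_recip R l2.
have b_param := tri_param_recip R (le_trans l2 lm).
case: v3 P3 al1 al2 g13 g23 ng33 v3_ideal {al3 nondeg} => [[x0 y0]|] P3 al1 al2 g13 g23 ng33;
  last first.
  move=> _; have [//|h [dh hP]] := triangle_normal_form refl P1 P2 _ ng11 ng33 al1 al2.
  exact: (CR_conjugate b_gt0 a_param b_param dh refl GE).
move=> /= y00; subst y0.
(* If the ideal vertex is a real point x0, the whole triangle is first moved so that this vertex is
   at infinity. *)
set k := inversion x0.
have dk : \det k != 0 by rewrite det_inversion oner_eq0.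
have dr (g : 'M[R]_2) : reflection g -> \det g != 0 by move=> [-> _]; rewrite oppr_eq0 oner_eq0.
have v3E : mobius (map_mx (real_complex R) k) (Some (Complex x0 0)) = None.
  by rewrite inversion_Some subrr /hpoint eqxx.
have mir (g : 'M[R]_2) p : reflection g -> on_mirror g p ->
    on_mirror (conjm k g) (mobius (map_mx (real_complex R) k) p).
  by move=> rg gp; apply/(mirror_conjm p dk (dr _ rg)).
have mir' (g : 'M[R]_2) p : reflection g -> ~ on_mirror g p ->
    ~ on_mirror (conjm k g) (mobius (map_mx (real_complex R) k) p).
  by move=> rg ngp /(mirror_conjm p dk (dr _ rg)).
have refl' : [/\ reflection (conjm k g1), reflection (conjm k g2) & reflection (conjm k g3)].
  by split; exact: reflection_conjm.
rewrite -(inversion_vertex_angle x0) v3E in al1.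
rewrite -(inversion_vertex_angle x0) v3E in al2.
have [||h [dh hP]] := triangle_normal_form refl' (inversion_in_closed_plane x0 P1)
  (inversion_in_closed_plane x0 P2) _ (mir' _ _ r1 ng11) _ al1 al2.
- by rewrite -v3E; split; split; exact: mir.
- by rewrite -v3E; exact: mir'.
have dhk : \det (h * k) != 0 by rewrite det_mul2 mulf_neq0.
rewrite !conjm_comp // in hP.
exact: (CR_conjugate b_gt0 a_param b_param dhk refl GE hP).
Qed.
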